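(* Let $\alpha\in[0,1)$ and let $f=h+\overline{g}\in\check{L}_H^{\alpha}$. Then for all $z\in\Delta$, the Jacobian $J_f(z)=|h'(z)|^2-|g'(z)|^2$ satisfies $$\frac{(1-\alpha^2)(1-|z|)^3}{(1+\alpha|z|)^2(1+|z|)^5}\leq J_f(z)\leq\begin{cases}\displaystyle \frac{(1-\alpha^2)(1+|z|)^3}{(1-\alpha|z|)^2(1-|z|)^5},&|z|<\alpha,\\[8pt]\displaystyle \frac{(1+|z|)^2}{(1-|z|)^6},&|z|\geq\alpha.\end{cases}$$
   Context: $\Delta$ is the open unit disc in $\mathbb{C}$. Every complex-valued harmonic function $f$ in $\Delta$ is uniquely represented as $f=h+\overline{g}$ with $h,g$ analytic in $\Delta$ and $g(0)=0$; write $h(z)=\sum_{n=0}^\infty a_nz^n$, $g(z)=\sum_{n=1}^\infty b_nz^n$. The Jacobian of $f$ is $J_f(z)=|h'(z)|^2-|g'(z)|^2$; $f$ is locally one-to-one and sense-preserving in $\Delta$ if and only if $J_f(z)>0$ for all $z\in\Delta$. $L_H$ denotes the set of all locally one-to-one and sense-preserving harmonic functions $f=h+\overline{g}$ in $\Delta$ with $h(0)=0$, $h'(0)=1$ (and $g(0)=0$). A starlike analytic function is a one-to-one analytic function in $\Delta$ fixing $0$ whose image is starlike with respect to the origin. For $\alpha\in[0,1)$, $\check{L}_H^{\alpha}$ is the class of all $f=h+\overline{g}\in L_H$ such that $|b_1|=|g'(0)|=\alpha$ and $h$ is a starlike analytic function. *)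

(* Defs.v *)
From Stdlib Require Import Reals.
From Coquelicot Require Export Coquelicot.

Open Scope R_scope.

Definition unit_disc (z : C) : Prop := Cmod z < 1.

(* With C as the scalar field, [ex_derive] is complex differentiability;
   [C_derive] then is the complex derivative ([is_C_derive_unique]). *)
Definition analytic_on_disc (h : C -> C) : Prop :=
  forall z : C, unit_disc z -> @ex_derive C_AbsRing C_NormedModule h z.

Definition one_to_one_on_disc (h : C -> C) : Prop :=
  forall z w : C, unit_disc z -> unit_disc w -> h z = h w -> z = w.

(* The harmonic functions in the (simply connected) disc are exactly the
   f = h + conj g with h, g analytic; g(0) = 0 makes h and g unique.
   Functions are total on C, but only their values on the disc matter. *)
Definition harmonic_decomposition (f h g : C -> C) : Prop :=
  analytic_on_disc h /\ analytic_on_disc g /\ g (RtoC 0) = RtoC 0 /\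
  (forall z : C, unit_disc z -> f z = Cplus (h z) (Cconj (g z))).

(* Jacobian of f = h + conj g. *)
Definition jacobian (h g : C -> C) (z : C) : R :=
  (Cmod (C_derive h z)) ^ 2 - (Cmod (C_derive g z)) ^ 2.

Definition locally_one_to_one (f : C -> C) : Prop :=
  forall z0 : C, unit_disc z0 ->
    exists r : R, 0 < r /\
      forall z w : C, unit_disc z -> unit_disc w ->
        Cmod (Cminus z z0) < r -> Cmod (Cminus w z0) < r ->
        f z = f w -> z = w.

Definition sense_preserving (h g : C -> C) : Prop :=
  forall z : C, unit_disc z -> 0 < jacobian h g z.

(* The class L_H, together with the canonical representation f = h + conj g. *)
Definition L_H (f h g : C -> C) : Prop :=
  harmonic_decomposition f h g /\
  locally_one_to_one f /\ sense_preserving h g /\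
  h (RtoC 0) = RtoC 0 /\ C_derive h (RtoC 0) = RtoC 1.

Definition starlike_image (h : C -> C) : Prop :=
  forall (z : C) (t : R), unit_disc z -> 0 <= t <= 1 ->
    exists w : C, unit_disc w /\ h w = Cmult (RtoC t) (h z).

Definition starlike_analytic (h : C -> C) : Prop :=
  analytic_on_disc h /\ one_to_one_on_disc h /\
  h (RtoC 0) = RtoC 0 /\ starlike_image h.

(* The subclass of L_H with |b_1| = alpha and starlike analytic part. *)
Definition L_H_starlike (alpha : R) (f h g : C -> C) : Prop :=
  L_H f h g /\ Cmod (C_derive g (RtoC 0)) = alpha /\ starlike_analytic h.

(* Main.v *)
(* Put omega = g'/h', so that J_f = |h'|^2 (1 - |omega|^2) with |omega| < 1 and |omega(0)| = alpha.
   The Schwarz lemma for (omega - omega(0)) / (1 - conj(omega(0)) omega) places |omega(z)| between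
   (alpha - |z|)/(1 - alpha |z|) and (alpha + |z|)/(1 + alpha |z|), and h obeys the distortion
   estimate (1 - |z|)/(1 + |z|)^3 <= |h'(z)| <= (1 + |z|)/(1 - |z|)^3.

   For the distortion estimate, the maps h^-1 (t h) fix 0 and send the disc into itself, so the
   Schwarz lemma as t -> 1 yields Re (z h'/h) >= 0.  With H = h/z this makes (h' - H)/(h' + H) a
   Schwarz function, hence |h' - H| <= |z| |h' + H|; this controls both h'/H and the derivative of
   |H|^2 along rays, so that |H(tz)|^2 (1 - t|z|)^4 decreases and |H(tz)|^2 (1 + t|z|)^4 increases.

   The Schwarz lemma and the holomorphy of h', g' and h/z rest on Cauchy's formula, obtained from
   Goursat's argument applied to circles shrinking to a point. *)

Require Import Defs.
From Stdlib Require Import Reals Lra Psatz ClassicalEpsilon.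
From Coquelicot Require Import Coquelicot.

Set Bullet Behavior "Strict Subproofs".

(** Positivity of the Jacobian does double duty: it gives [|omega| < 1], and it makes [h']
    zero-free. With [h'] zero-free, differentiability of [h^-1] reduces to local surjectivity of
    [h], which a minimum of [|h - w|] provides. Goursat's bisection is carried out on a rectangle of
    homotopy parameters instead of on triangles in the plane, so neither primitives nor the geometry
    of the image enter. Contour integrals are real integrals over the angle; the factor i of
    [dz = i z dt] is divided out, which is why [2 PI] appears where [2 PI i] would be usual. Both
    two-sided estimates (on the real part of [h'/H] and on [|omega|]) are obtained as the sign of a
    product of two linear factors; a linear combination of the factors with known sign then tells
    them apart. The case split at [|z| = alpha] comes from the lower bound for [|omega|]: for
    [|z| >= alpha] its numerator [alpha - |z|] is no longer positive, and only [1 - |omega|^2 <= 1]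
    is left. *)

(** * Modulus inequalities *)

Lemma Cmod_minus_sym (z w : C) : Cmod (z - w) = Cmod (w - z).
Proof. replace (z - w)%C with (- (w - z))%C by ring. apply Cmod_opp. Qed.

Lemma Cmod_minus_triangle (x y z : C) : Cmod (x - z) <= Cmod (x - y) + Cmod (y - z).
Proof. replace (x - z)%C with ((x - y) + (y - z))%C by ring. apply Cmod_triangle. Qed.

Lemma Cmod_reverse_triangle (x y : C) : Cmod x - Cmod y <= Cmod (x - y).
Proof.
  replace x with ((x - y) + y)%C at 1 by ring.
  pose proof (Cmod_triangle (x - y) y). lra.
Qed.

Lemma Re_Im_le_Cmod (z : C) : Rabs (Re z) <= Cmod z /\ Rabs (Im z) <= Cmod z.
Proof.
  pose proof (Rmax_Cmod z). unfold Re, Im.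
  pose proof (Rmax_l (Rabs (fst z)) (Rabs (snd z))).
  pose proof (Rmax_r (Rabs (fst z)) (Rabs (snd z))). lra.
Qed.

Lemma Cmod_le_Re_Im (z : C) : Cmod z <= Rabs (Re z) + Rabs (Im z).
Proof.
  pose proof (Rabs_pos (Re z)). pose proof (Rabs_pos (Im z)).
  apply Rsqr_incr_0; try lra; [|apply Cmod_ge_0].
  rewrite !Rsqr_pow2, Cmod2_alt.
  rewrite <- (pow2_abs (Re z)), <- (pow2_abs (Im z)). nra.
Qed.

(** * Differentiability and continuity in epsilon-delta form *)

(** Stated without division, so [w = z] needs no exception and the affine approximation used by
    Goursat's argument can be read off directly. *)
Definition Cderiv (f : C -> C) (z l : C) : Prop :=
  forall eps : R, 0 < eps -> exists delta : R, 0 < delta /\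
    forall w : C, Cmod (w - z) < delta ->
      Cmod (f w - f z - l * (w - z)) <= eps * Cmod (w - z).

Definition Ccont (f : C -> C) (z : C) : Prop :=
  forall eps : R, 0 < eps -> exists delta : R, 0 < delta /\
    forall w : C, Cmod (w - z) < delta -> Cmod (f w - f z) < eps.

Definition Rcont (f : R -> C) (t : R) : Prop :=
  forall eps : R, 0 < eps -> exists delta : R, 0 < delta /\
    forall u : R, Rabs (u - t) < delta -> Cmod (f u - f t) < eps.

(** Componentwise, so that the real derivative and the real fundamental theorem of calculus apply to
    each coordinate. *)
Definition Rderiv (f : R -> C) (t : R) (l : C) : Prop :=
  is_derive (fun u => Re (f u)) t (Re l) /\ is_derive (fun u => Im (f u)) t (Im l).

Lemma Cderiv_correct (f : C -> C) (z : C) :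
  @ex_derive C_AbsRing C_NormedModule f z -> Cderiv f z (C_derive f z).
Proof.
  intros H. apply C_derive_correct in H; [|exact z].
  destruct H as [_ H]. intros eps He.
  destruct (H z (fun P HP => HP) (mkposreal eps He)) as [d Hd].
  exists d. split. apply cond_pos.
  intros w Hw. specialize (Hd w Hw).
  replace (f w - f z - C_derive f z * (w - z))%C
    with (f w - f z - (w - z) * C_derive f z)%C by ring.
  exact Hd.
Qed.

Lemma Cderiv_cont (f : C -> C) (z l : C) : Cderiv f z l -> Ccont f z.
Proof.
  intros H eps He. destruct (H 1 Rlt_0_1) as [d [Hd H1]].
  pose proof (Cmod_ge_0 l).
  assert (Hp : 0 < eps / (2 + Cmod l)) by (apply Rdiv_lt_0_compat; lra).
  exists (Rmin d (eps / (2 + Cmod l))). split. now apply Rmin_pos.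
  intros w Hw.
  assert (Hw1 := Rlt_le_trans _ _ _ Hw (Rmin_l _ _)).
  assert (Hw2 := Rlt_le_trans _ _ _ Hw (Rmin_r _ _)).
  specialize (H1 w Hw1).
  replace (f w - f z)%C with ((f w - f z - l * (w - z)) + l * (w - z))%C by ring.
  eapply Rle_lt_trans. apply Cmod_triangle. rewrite Cmod_mult.
  apply (Rmult_lt_compat_r (2 + Cmod l)) in Hw2; [|lra].
  unfold Rdiv in Hw2. rewrite Rmult_assoc, Rinv_l in Hw2 by lra.
  pose proof (Cmod_ge_0 (w - z)). nra.
Qed.

Lemma Cderiv_ext_loc (f g : C -> C) (z l : C) (d : R) :
  0 < d -> (forall w, Cmod (w - z) < d -> f w = g w) -> Cderiv f z l -> Cderiv g z l.
Proof.
  intros Hd E H eps He. destruct (H eps He) as [d' [Hd' H1]].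
  exists (Rmin d d'). split. now apply Rmin_pos.
  intros w Hw. rewrite <- !E.
  - apply H1. eapply Rlt_le_trans; [exact Hw|apply Rmin_r].
  - replace (z - z)%C with (RtoC 0) by ring. now rewrite Cmod_0.
  - eapply Rlt_le_trans; [exact Hw|apply Rmin_l].
Qed.

Lemma Cderiv_const (c z : C) : Cderiv (fun _ => c) z 0.
Proof.
  intros eps He. exists 1. split. lra. intros w _.
  replace (c - c - 0 * (w - z))%C with (RtoC 0) by ring. rewrite Cmod_0.
  apply Rmult_le_pos. lra. apply Cmod_ge_0.
Qed.

Lemma Cderiv_id (z : C) : Cderiv (fun w => w) z 1.
Proof.
  intros eps He. exists 1. split. lra. intros w _.
  replace (w - z - 1 * (w - z))%C with (RtoC 0) by ring. rewrite Cmod_0.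
  apply Rmult_le_pos. lra. apply Cmod_ge_0.
Qed.

Lemma Cderiv_plus (f g : C -> C) (z a b : C) :
  Cderiv f z a -> Cderiv g z b -> Cderiv (fun w => f w + g w)%C z (a + b).
Proof.
  intros Hf Hg eps He.
  destruct (Hf (eps / 2)) as [d1 [Hd1 H1]]. lra.
  destruct (Hg (eps / 2)) as [d2 [Hd2 H2]]. lra.
  exists (Rmin d1 d2). split. now apply Rmin_pos.
  intros w Hw.
  specialize (H1 w (Rlt_le_trans _ _ _ Hw (Rmin_l _ _))).
  specialize (H2 w (Rlt_le_trans _ _ _ Hw (Rmin_r _ _))).
  replace (f w + g w - (f z + g z) - (a + b) * (w - z))%C
    with ((f w - f z - a * (w - z)) + (g w - g z - b * (w - z)))%C by ring.
  eapply Rle_trans. apply Cmod_triangle. lra.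
Qed.

Lemma Cderiv_mult (f g : C -> C) (z a b : C) :
  Cderiv f z a -> Cderiv g z b ->
  Cderiv (fun w => f w * g w)%C z (a * g z + f z * b).
Proof.
  intros Hf Hg eps He.
  (* [M] dominates [|f z|], [|a|] and, once [|g w - g z| < 1], also [|g w|]. The error splits into
     three terms, each at most [e M |w - z|], hence the 3 in [e]. *)
  set (M := 1 + Cmod (f z) + Cmod (g z) + Cmod a).
  pose proof (Cmod_ge_0 (f z)) as P1. pose proof (Cmod_ge_0 (g z)) as P2. pose proof (Cmod_ge_0 a) as P3.
  assert (HM : 1 <= M) by (unfold M; lra).
  set (e := eps / (3 * M)).
  assert (He' : 0 < e) by (apply Rdiv_lt_0_compat; lra).
  assert (Ee : e * M = eps / 3) by (unfold e; field; lra).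
  destruct (Hf e He') as [d1 [Hd1 H1]].
  destruct (Hg e He') as [d2 [Hd2 H2]].
  destruct (Cderiv_cont g z b Hg (Rmin 1 e)) as [d3 [Hd3 H3]]. apply Rmin_pos; lra.
  exists (Rmin d1 (Rmin d2 d3)). split. repeat apply Rmin_pos; lra.
  intros w Hw.
  assert (Hw1 := Rlt_le_trans _ _ _ Hw (Rmin_l _ _)).
  assert (Hw' := Rlt_le_trans _ _ _ Hw (Rmin_r _ _)).
  assert (Hw2 := Rlt_le_trans _ _ _ Hw' (Rmin_l _ _)).
  assert (Hw3 := Rlt_le_trans _ _ _ Hw' (Rmin_r _ _)).
  specialize (H1 w Hw1). specialize (H2 w Hw2). specialize (H3 w Hw3).
  assert (H3a := Rlt_le_trans _ _ _ H3 (Rmin_l _ _)).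
  assert (H3b := Rlt_le_trans _ _ _ H3 (Rmin_r _ _)).
  replace (f w * g w - f z * g z - (a * g z + f z * b) * (w - z))%C
    with ((f w - f z - a * (w - z)) * ((g w - g z) + g z)
          + (f z * (g w - g z - b * (w - z)) + a * (w - z) * (g w - g z)))%C by ring.
  eapply Rle_trans. apply Cmod_triangle.
  eapply Rle_trans. apply Rplus_le_compat_l, Cmod_triangle.
  rewrite !Cmod_mult.
  pose proof (Cmod_triangle (g w - g z) (g z)).
  pose proof (Cmod_ge_0 (w - z)). pose proof (Cmod_ge_0 (g w - g z)).
  pose proof (Cmod_ge_0 (g w - g z + g z)).
  assert (Cmod (f w - f z - a * (w - z)) * Cmod (g w - g z + g z) <= (e * Cmod (w - z)) * M).
  { apply Rmult_le_compat; try apply Cmod_ge_0; unfold M in *; lra. }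
  assert (Cmod (f z) * Cmod (g w - g z - b * (w - z)) <= M * (e * Cmod (w - z))).
  { apply Rmult_le_compat; try apply Cmod_ge_0; unfold M in *; lra. }
  assert (Cmod a * Cmod (w - z) * Cmod (g w - g z) <= (M * Cmod (w - z)) * e).
  { apply Rmult_le_compat; try apply Cmod_ge_0; try lra. apply Rmult_le_pos; lra.
    apply Rmult_le_compat_r; unfold M in *; lra. }
  assert (E3 : eps * Cmod (w - z) = 3 * ((e * M) * Cmod (w - z))) by (rewrite Ee; field).
  nra.
Qed.

Lemma Cderiv_comp (f g : C -> C) (z a b : C) :
  Cderiv f (g z) a -> Cderiv g z b -> Cderiv (fun w => f (g w)) z (a * b).
Proof.
  intros Hf Hg eps He.
  pose proof (Cmod_ge_0 a) as P1. pose proof (Cmod_ge_0 b) as P2.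
  set (e := eps / (2 * (1 + Cmod b))).
  assert (He' : 0 < e) by (apply Rdiv_lt_0_compat; lra).
  assert (Ee : e * (1 + Cmod b) = eps / 2) by (unfold e; field; lra).
  (* The bound 1 yields [|g w - g z| <= (1 + |b|) |w - z|]; the other bound absorbs the factor [|a|]
     in front of the error of [g]. *)
  set (e2 := Rmin 1 (eps / (2 * (1 + Cmod a)))).
  assert (He2 : 0 < e2).
  { apply Rmin_pos. lra. apply Rdiv_lt_0_compat; lra. }
  assert (Ee2 : e2 * (1 + Cmod a) <= eps / 2).
  { eapply Rle_trans. apply Rmult_le_compat_r; [lra|apply Rmin_r]. right. field. lra. }
  assert (Ee3 : e2 <= 1) by apply Rmin_l.
  destruct (Hf e He') as [d1 [Hd1 H1]].
  destruct (Hg e2 He2) as [d2 [Hd2 H2]].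
  destruct (Cderiv_cont g z b Hg d1 Hd1) as [d3 [Hd3 H3]].
  exists (Rmin d2 d3). split. now apply Rmin_pos.
  intros w Hw.
  specialize (H2 w (Rlt_le_trans _ _ _ Hw (Rmin_l _ _))).
  specialize (H3 w (Rlt_le_trans _ _ _ Hw (Rmin_r _ _))).
  specialize (H1 _ H3).
  replace (f (g w) - f (g z) - a * b * (w - z))%C
    with ((f (g w) - f (g z) - a * (g w - g z)) + a * (g w - g z - b * (w - z)))%C by ring.
  eapply Rle_trans. apply Cmod_triangle. rewrite Cmod_mult.
  assert (Cmod (g w - g z) <= (1 + Cmod b) * Cmod (w - z)).
  { replace (g w - g z)%C with ((g w - g z - b * (w - z)) + b * (w - z))%C by ring.
    eapply Rle_trans. apply Cmod_triangle. rewrite Cmod_mult.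
    pose proof (Cmod_ge_0 (w - z)). nra. }
  pose proof (Cmod_ge_0 (w - z)).
  assert (e * Cmod (g w - g z) <= eps / 2 * Cmod (w - z)).
  { rewrite <- Ee, Rmult_assoc. apply Rmult_le_compat_l; lra. }
  assert (Cmod a * Cmod (g w - g z - b * (w - z)) <= eps / 2 * Cmod (w - z)).
  { eapply Rle_trans. apply Rmult_le_compat_l; [lra|exact H2].
    rewrite <- Rmult_assoc. apply Rmult_le_compat_r; nra. }
  lra.
Qed.

Lemma Cderiv_inv (z : C) : z <> 0 -> Cderiv Cinv z (- / (z * z)).
Proof.
  intros Hz eps He. assert (Hm : 0 < Cmod z) by now apply Cmod_gt_0.
  set (m := Cmod z) in *.
  (* The error is exactly [(w - z)^2 / (z^2 w)]. The first radius gives [|w| >= m / 2], so the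
     denominator is at least [m^3 / 2] in modulus, which explains the second. *)
  exists (Rmin (m / 2) (eps * m ^ 3 / 2)). split.
  { apply Rmin_pos. lra. apply Rdiv_lt_0_compat; [|lra].
    apply Rmult_lt_0_compat; [lra|]. now apply pow_lt. }
  intros w Hw.
  assert (Hw1 := Rlt_le_trans _ _ _ Hw (Rmin_l _ _)).
  assert (Hw2 := Rlt_le_trans _ _ _ Hw (Rmin_r _ _)).
  assert (Hwm : m / 2 <= Cmod w).
  { pose proof (Cmod_reverse_triangle z w). rewrite Cmod_minus_sym in H. fold m in H. lra. }
  assert (Hwz : w <> 0). { apply Cmod_gt_0. lra. }
  replace (/ w - / z - - / (z * z) * (w - z))%C
    with ((w - z) * (w - z) * / (z * z * w))%C by (field; auto).
  assert (Hn : (z * z * w)%C <> 0) by (repeat apply Cmult_neq_0; auto).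
  rewrite !Cmod_mult, Cmod_inv, !Cmod_mult by auto. fold m.
  apply (Rmult_le_reg_r (m * m * Cmod w)). { repeat apply Rmult_lt_0_compat; lra. }
  rewrite Rmult_assoc, Rinv_l by (repeat apply Rmult_integral_contrapositive_currified; lra).
  pose proof (Cmod_ge_0 (w - z)).
  assert (eps * m ^ 3 / 2 <= eps * (m * m * Cmod w)).
  { replace (eps * m ^ 3 / 2) with (eps * (m * m * (m / 2))) by field.
    apply Rmult_le_compat_l. lra. apply Rmult_le_compat_l; nra. }
  nra.
Qed.

Lemma Cderiv_minus (f g : C -> C) (z a b : C) :
  Cderiv f z a -> Cderiv g z b -> Cderiv (fun w => f w - g w)%C z (a - b).
Proof.
  intros Hf Hg.
  replace (a - b)%C with (a + (0 * g z + - (1) * b))%C by ring.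
  apply Cderiv_ext_loc with (f := fun w => (f w + - (1) * g w)%C) (d := 1).
  - lra.
  - intros; ring.
  - apply Cderiv_plus; auto. apply (Cderiv_mult (fun _ => (- (1))%C)); auto. apply Cderiv_const.
Qed.

Lemma Cderiv_div (f g : C -> C) (z a b : C) :
  Cderiv f z a -> Cderiv g z b -> g z <> 0 ->
  Cderiv (fun w => f w / g w)%C z ((a * g z - f z * b) / (g z * g z)).
Proof.
  intros Hf Hg Hz.
  replace ((a * g z - f z * b) / (g z * g z))%C
    with (a * / g z + f z * (- / (g z * g z) * b))%C by (field; auto).
  apply (Cderiv_mult f (fun w => / g w)%C); auto.
  apply (Cderiv_comp Cinv g); auto. now apply Cderiv_inv.
Qed.

Lemma Cderiv_pow (f : C -> C) (z l : C) (n : nat) :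
  Cderiv f z l -> exists l', Cderiv (fun w => f w ^ n)%C z l'.
Proof.
  intros H. induction n as [|n [l' IH]].
  - exists 0. exact (Cderiv_const 1 z).
  - eexists. simpl. apply (Cderiv_mult f (fun w => f w ^ n)%C); eauto.
Qed.

Lemma Rcont_const (c : C) (t : R) : Rcont (fun _ => c) t.
Proof.
  intros eps He. exists 1. split. lra. intros. replace (c - c)%C with (RtoC 0) by ring.
  now rewrite Cmod_0.
Qed.

Lemma Rcont_comp (f : C -> C) (g : R -> C) (t : R) :
  Ccont f (g t) -> Rcont g t -> Rcont (fun u => f (g u)) t.
Proof.
  intros Hf Hg eps He. destruct (Hf eps He) as [d [Hd H]].
  destruct (Hg d Hd) as [d' [Hd' H']]. exists d'. split; auto.
Qed.

Lemma Rcont_plus (f g : R -> C) (t : R) :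
  Rcont f t -> Rcont g t -> Rcont (fun u => f u + g u)%C t.
Proof.
  intros Hf Hg eps He.
  destruct (Hf (eps / 2)) as [d1 [Hd1 H1]]. lra.
  destruct (Hg (eps / 2)) as [d2 [Hd2 H2]]. lra.
  exists (Rmin d1 d2). split. now apply Rmin_pos.
  intros u Hu.
  specialize (H1 u (Rlt_le_trans _ _ _ Hu (Rmin_l _ _))).
  specialize (H2 u (Rlt_le_trans _ _ _ Hu (Rmin_r _ _))).
  replace (f u + g u - (f t + g t))%C with ((f u - f t) + (g u - g t))%C by ring.
  eapply Rle_lt_trans. apply Cmod_triangle. lra.
Qed.

Lemma Rcont_mult (f g : R -> C) (t : R) :
  Rcont f t -> Rcont g t -> Rcont (fun u => f u * g u)%C t.
Proof.
  intros Hf Hg eps He.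
  set (M := 1 + Cmod (f t) + Cmod (g t)).
  pose proof (Cmod_ge_0 (f t)) as P1. pose proof (Cmod_ge_0 (g t)) as P2.
  assert (HM : 1 <= M) by (unfold M; lra).
  set (e := Rmin 1 (eps / (2 * M))).
  assert (He' : 0 < e) by (apply Rmin_pos; [lra|apply Rdiv_lt_0_compat; lra]).
  assert (Ee : e * M <= eps / 2).
  { eapply Rle_trans. apply Rmult_le_compat_r; [lra|apply Rmin_r]. right. field. lra. }
  assert (Ee3 : e <= 1) by apply Rmin_l.
  destruct (Hf e He') as [d1 [Hd1 H1]].
  destruct (Hg e He') as [d2 [Hd2 H2]].
  exists (Rmin d1 d2). split. now apply Rmin_pos.
  intros u Hu.
  specialize (H1 u (Rlt_le_trans _ _ _ Hu (Rmin_l _ _))).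
  specialize (H2 u (Rlt_le_trans _ _ _ Hu (Rmin_r _ _))).
  replace (f u * g u - f t * g t)%C
    with ((f u - f t) * (g u - g t) + (f t * (g u - g t) + (f u - f t) * g t))%C by ring.
  eapply Rle_lt_trans. apply Cmod_triangle.
  eapply Rle_lt_trans. apply Rplus_le_compat_l, Cmod_triangle.
  rewrite !Cmod_mult.
  pose proof (Cmod_ge_0 (f u - f t)). pose proof (Cmod_ge_0 (g u - g t)).
  assert (Cmod (f u - f t) * Cmod (g u - g t) <= 1 * Cmod (g u - g t)) by (apply Rmult_le_compat_r; lra).
  unfold M in Ee. nra.
Qed.

Lemma Rcont_minus (f g : R -> C) (t : R) :
  Rcont f t -> Rcont g t -> Rcont (fun u => f u - g u)%C t.
Proof.
  intros Hf Hg. apply Rcont_plus; auto.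
  intros e He. destruct (Hg e He) as [d [Hd H]]. exists d. split; auto.
  intros u Hu. replace (- g u - - g t)%C with (- (g u - g t))%C by ring. rewrite Cmod_opp. auto.
Qed.

Lemma Rcont_Rderiv (f : R -> C) (t : R) (l : C) : Rderiv f t l -> Rcont f t.
Proof.
  intros [H1 H2] eps He.
  assert (C1 : continuous (fun u => Re (f u)) t) by (apply @ex_derive_continuous; now exists (Re l)).
  assert (C2 : continuous (fun u => Im (f u)) t) by (apply @ex_derive_continuous; now exists (Im l)).
  assert (He2 : 0 < eps / 2) by lra.
  destruct (proj1 (filterlim_locally _ _) C1 (mkposreal _ He2)) as [d1 Hd1].
  destruct (proj1 (filterlim_locally _ _) C2 (mkposreal _ He2)) as [d2 Hd2].
  exists (Rmin d1 d2). split. apply Rmin_pos; apply cond_pos.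
  intros u Hu.
  specialize (Hd1 u (Rlt_le_trans _ _ _ Hu (Rmin_l _ _))).
  specialize (Hd2 u (Rlt_le_trans _ _ _ Hu (Rmin_r _ _))).
  change (Rabs (Re (f u) - Re (f t)) < eps / 2) in Hd1.
  change (Rabs (Im (f u) - Im (f t)) < eps / 2) in Hd2.
  eapply Rle_lt_trans. apply Cmod_le_Re_Im.
  change (Rabs (Re (f u) - Re (f t)) + Rabs (Im (f u) - Im (f t)) < eps). lra.
Qed.

Lemma Rcont_components (f : R -> C) (t : R) :
  Rcont f t -> continuous (fun u => Re (f u)) t /\ continuous (fun u => Im (f u)) t.
Proof.
  intros H. split; apply filterlim_locally; intros eps;
  destruct (H eps (cond_pos eps)) as [d [Hd Hu]]; exists (mkposreal d Hd); intros u Hb;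
  specialize (Hu u Hb); eapply Rle_lt_trans; try exact Hu;
  apply (Re_Im_le_Cmod (f u - f t)).
Qed.

Lemma Rderiv_const (c : C) (t : R) : Rderiv (fun _ => c) t 0.
Proof. split; simpl; apply @is_derive_const. Qed.

Lemma Rderiv_plus (f g : R -> C) (t : R) (a b : C) :
  Rderiv f t a -> Rderiv g t b -> Rderiv (fun u => f u + g u)%C t (a + b).
Proof.
  intros [F1 F2] [G1 G2]. split.
  - apply (is_derive_plus (fun u => Re (f u)) (fun u => Re (g u)) t _ _ F1 G1).
  - apply (is_derive_plus (fun u => Im (f u)) (fun u => Im (g u)) t _ _ F2 G2).
Qed.

Lemma Rderiv_mult (f g : R -> C) (t : R) (a b : C) :
  Rderiv f t a -> Rderiv g t b ->
  Rderiv (fun u => f u * g u)%C t (a * g t + f t * b).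
Proof.
  intros [F1 F2] [G1 G2].
  pose proof (is_derive_mult _ _ t _ _ F1 G1 Rmult_comm) as P11.
  pose proof (is_derive_mult _ _ t _ _ F2 G2 Rmult_comm) as P22.
  pose proof (is_derive_mult _ _ t _ _ F1 G2 Rmult_comm) as P12.
  pose proof (is_derive_mult _ _ t _ _ F2 G1 Rmult_comm) as P21.
  split.
  - pose proof (is_derive_minus _ _ t _ _ P11 P22) as Q.
    evar_last. exact Q.
    unfold minus, plus, mult, opp, Re, Im, Cmult, Cplus; simpl. ring.
  - pose proof (is_derive_plus _ _ t _ _ P12 P21) as Q.
    evar_last. exact Q.
    unfold minus, plus, mult, opp, Re, Im, Cmult, Cplus; simpl. ring.
Qed.

Lemma Rderiv_eq (f : R -> C) (t : R) (a b : C) : Rderiv f t a -> a = b -> Rderiv f t b.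
Proof. now intros H <-. Qed.

Lemma Cderiv_eq (f : C -> C) (z a b : C) : Cderiv f z a -> a = b -> Cderiv f z b.
Proof. now intros H <-. Qed.

Lemma Rderiv_RtoC (t : R) : Rderiv RtoC t 1.
Proof. split; simpl. apply @is_derive_id. apply @is_derive_const. Qed.

(** * Integrals of complex functions of a real variable *)

Definition CInt (f : R -> C) (a b : R) : C :=
  (RInt (fun t => Re (f t)) a b, RInt (fun t => Im (f t)) a b).

(** Two-sided continuity is demanded even at the endpoints; the integrands are defined on the whole
    line and satisfy it. *)
Definition Rcont_on (f : R -> C) (a b : R) : Prop := forall t, a <= t <= b -> Rcont f t.

Lemma ex_RInt_components (f : R -> C) (a b : R) :
  a <= b -> Rcont_on f a b ->
  ex_RInt (fun t => Re (f t)) a b /\ ex_RInt (fun t => Im (f t)) a b.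
Proof.
  intros Hab H.
  split; apply (ex_RInt_continuous (V := R_CompleteNormedModule));
  rewrite Rmin_left, Rmax_right by lra; intros t Ht; apply (Rcont_components f t (H t Ht)).
Qed.

(** The norm of C as a real product module coincides with [Cmod], so the vector-valued estimate
    applies with the sharp constant; estimating the two components separately would lose a
    factor. *)
Lemma CInt_bound (f : R -> C) (a b M : R) :
  a <= b -> Rcont_on f a b -> (forall t, a <= t <= b -> Cmod (f t) <= M) ->
  Cmod (CInt f a b) <= M * (b - a).
Proof.
  intros Hab H HM.
  destruct (ex_RInt_components f a b Hab H) as [E1 E2].
  apply (RInt_correct (V := R_CompleteNormedModule)) in E1.
  apply (RInt_correct (V := R_CompleteNormedModule)) in E2.
  pose proof (is_RInt_fct_extend_pair (U := R_NormedModule) (V := R_NormedModule) f a b _ _ E1 E2) as E.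
  pose proof (norm_RInt_le (V := C_R_NormedModule) f (fun _ => M) a b (CInt f a b) (scal (b - a) M) Hab) as N.
  assert (Hn : forall z : C, @norm _ C_R_NormedModule z = Cmod z).
  { intros z. unfold norm; simpl. unfold prod_norm, norm; simpl. unfold abs; simpl.
    unfold Cmod. f_equal. rewrite <- (pow2_abs (fst z)), <- (pow2_abs (snd z)). simpl. ring. }
  rewrite Hn in N.
  replace (M * (b - a)) with (scal (b - a) M) by (unfold scal; simpl; unfold mult; simpl; ring).
  apply N; auto.
  - intros t Ht. rewrite Hn. auto.
  - apply @is_RInt_const.
Qed.

Lemma CInt_ext (f g : R -> C) (a b : R) :
  a <= b -> (forall t, a <= t <= b -> f t = g t) -> CInt f a b = CInt g a b.
Proof.
  intros Hab H. unfold CInt. f_equal; apply RInt_ext;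
  rewrite Rmin_left, Rmax_right by lra; intros t Ht; rewrite H; auto; lra.
Qed.

Lemma CInt_plus (f g : R -> C) (a b : R) :
  a <= b -> Rcont_on f a b -> Rcont_on g a b ->
  CInt (fun t => f t + g t)%C a b = (CInt f a b + CInt g a b)%C.
Proof.
  intros Hab Hf Hg.
  destruct (ex_RInt_components f a b Hab Hf). destruct (ex_RInt_components g a b Hab Hg).
  unfold CInt, Cplus; simpl. f_equal.
  - now apply (RInt_plus (fun t => Re (f t)) (fun t => Re (g t))).
  - now apply (RInt_plus (fun t => Im (f t)) (fun t => Im (g t))).
Qed.

Lemma CInt_scal (f : R -> C) (c : C) (a b : R) :
  a <= b -> Rcont_on f a b ->
  CInt (fun t => c * f t)%C a b = (c * CInt f a b)%C.
Proof.
  intros Hab Hf.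
  destruct (ex_RInt_components f a b Hab Hf) as [E1 E2].
  pose proof (RInt_correct (V := R_CompleteNormedModule) _ _ _ E1) as I1.
  pose proof (RInt_correct (V := R_CompleteNormedModule) _ _ _ E2) as I2.
  unfold CInt, Cmult; simpl. f_equal.
  - apply is_RInt_unique.
    exact (is_RInt_minus _ _ a b _ _ (is_RInt_scal _ a b (fst c) _ I1) (is_RInt_scal _ a b (snd c) _ I2)).
  - apply is_RInt_unique.
    exact (is_RInt_plus _ _ a b _ _ (is_RInt_scal _ a b (fst c) _ I2) (is_RInt_scal _ a b (snd c) _ I1)).
Qed.

Lemma CInt_minus (f g : R -> C) (a b : R) :
  a <= b -> Rcont_on f a b -> Rcont_on g a b ->
  CInt (fun t => f t - g t)%C a b = (CInt f a b - CInt g a b)%C.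
Proof.
  intros Hab Hf Hg.
  rewrite (CInt_ext _ (fun t => f t + - (1) * g t)%C); auto.
  - rewrite CInt_plus, CInt_scal; auto. ring.
    intros t Ht. apply Rcont_mult; auto. apply Rcont_const.
  - intros. ring.
Qed.

Lemma CInt_conj (f : R -> C) (a b : R) :
  a <= b -> Rcont_on f a b -> CInt (fun t => Cconj (f t)) a b = Cconj (CInt f a b).
Proof.
  intros Hab Hf.
  destruct (ex_RInt_components f a b Hab Hf) as [E1 E2].
  unfold CInt, Cconj; simpl. f_equal. now apply (RInt_opp (fun t => Im (f t))).
Qed.

Lemma CInt_const (c : C) (a b : R) : CInt (fun _ => c) a b = (RtoC (b - a) * c)%C.
Proof.
  unfold CInt. rewrite !RInt_const. unfold Cmult, scal; simpl. unfold mult; simpl.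
  unfold Re, Im. f_equal; ring.
Qed.

Lemma CInt_Chasles (f : R -> C) (a b c : R) :
  a <= b <= c -> Rcont_on f a c -> CInt f a c = (CInt f a b + CInt f b c)%C.
Proof.
  intros Hab Hf.
  destruct (ex_RInt_components f a b) as [E1 E2]. lra. intros t Ht; apply Hf; lra.
  destruct (ex_RInt_components f b c) as [E3 E4]. lra. intros t Ht; apply Hf; lra.
  unfold CInt, Cplus; simpl. f_equal; symmetry; apply @RInt_Chasles; auto.
Qed.

Lemma CInt_deriv (f df : R -> C) (a b : R) :
  a <= b -> (forall t, a <= t <= b -> Rderiv f t (df t)) -> Rcont_on df a b ->
  CInt df a b = (f b - f a)%C.
Proof.
  intros Hab H Hc. unfold CInt. rewrite (surjective_pairing (f b - f a)%C).
  f_equal; apply is_RInt_unique.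
  - apply (is_RInt_derive (fun t => Re (f t)) (fun t => Re (df t)));
    rewrite Rmin_left, Rmax_right by lra; intros t Ht.
    apply H; auto. apply Rcont_components; auto.
  - apply (is_RInt_derive (fun t => Im (f t)) (fun t => Im (df t)));
    rewrite Rmin_left, Rmax_right by lra; intros t Ht.
    apply H; auto. apply Rcont_components; auto.
Qed.

(** * Cauchy's theorem *)

(** The supremum of the left endpoints works, because every left endpoint lies below every right
    endpoint. *)
Lemma nested_intervals (a b : nat -> R) :
  (forall n, a n <= a (S n)) -> (forall n, b (S n) <= b n) -> (forall n, a n <= b n) ->
  exists u, forall n, a n <= u <= b n.
Proof.
  intros Ha Hb Hab.
  assert (Ma : forall n k, a n <= a (n + k)%nat).
  { intros n k. induction k. rewrite Nat.add_0_r; lra.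
    rewrite Nat.add_succ_r. eapply Rle_trans; [exact IHk|apply Ha]. }
  assert (Mb : forall n k, b (n + k)%nat <= b n).
  { intros n k. induction k. rewrite Nat.add_0_r; lra.
    rewrite Nat.add_succ_r. eapply Rle_trans; [apply Hb|exact IHk]. }
  assert (Mab : forall n m, a n <= b m).
  { intros n m. eapply Rle_trans. apply (Ma n m). eapply Rle_trans. apply Hab.
    rewrite Nat.add_comm. apply Mb. }
  destruct (completeness (fun x => exists n, x = a n)) as [u [U1 U2]].
  - exists (b O). intros x [n ->]. apply Mab.
  - exists (a O). now exists O.
  - exists u. intros n. split.
    + apply U1. now exists n.
    + apply U2. intros x [m ->]. apply Mab.
Qed.

(** A parameter rectangle: the first pair bounds [s], the second bounds [t]. *)
Definition cell : Type := ((R * R) * (R * R))%type.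

(** Half the perimeter. It halves under bisection, so its square is divided by four, as an area
    would be. *)
Definition cell_size (c : cell) : R := (snd (fst c) - fst (fst c)) + (snd (snd c) - fst (snd c)).

(** Includes that the endpoints of [c'] are in order; thus [cell_sub c c] says precisely that [c] is
    a genuine rectangle. *)
Definition cell_sub (c c' : cell) : Prop :=
  fst (fst c) <= fst (fst c') /\ fst (fst c') <= snd (fst c') /\ snd (fst c') <= snd (fst c) /\
  fst (snd c) <= fst (snd c') /\ fst (snd c') <= snd (snd c') /\ snd (snd c') <= snd (snd c).

Definition cell_mem (c : cell) (u v : R) : Prop :=
  fst (fst c) <= u <= snd (fst c) /\ fst (snd c) <= v <= snd (snd c).

(** If all four quarters obeyed the bound, additivity would give
    [|Phi| <= 4 eps (size / 2)^2 = eps size^2] on the whole cell. *)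
Lemma additive_rect_bisect (Phi : R -> R -> R -> R -> C) (eps : R) (c : cell) :
  cell_sub c c ->
  (forall s0 s1 s2 t0 t1, cell_sub c ((s0, s1), (t0, t1)) -> cell_sub c ((s1, s2), (t0, t1)) ->
    Phi s0 s2 t0 t1 = (Phi s0 s1 t0 t1 + Phi s1 s2 t0 t1)%C) ->
  (forall s0 s1 t0 t1 t2, cell_sub c ((s0, s1), (t0, t1)) -> cell_sub c ((s0, s1), (t1, t2)) ->
    Phi s0 s1 t0 t2 = (Phi s0 s1 t0 t1 + Phi s0 s1 t1 t2)%C) ->
  eps * cell_size c ^ 2 < Cmod (Phi (fst (fst c)) (snd (fst c)) (fst (snd c)) (snd (snd c))) ->
  exists c' : cell, cell_sub c c' /\ cell_size c' = cell_size c / 2 /\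
    eps * cell_size c' ^ 2 < Cmod (Phi (fst (fst c')) (snd (fst c')) (fst (snd c')) (snd (snd c'))).
Proof.
  destruct c as [[s0 s1] [t0 t1]]. unfold cell_sub, cell_size; simpl fst; simpl snd.
  intros Hc As At Hbad.
  set (s := (s0 + s1) / 2). set (t := (t0 + t1) / 2).
  assert (Hs : s0 <= s <= s1) by (unfold s; lra).
  assert (Ht : t0 <= t <= t1) by (unfold t; lra).
  apply NNPP. intros Hno.
  assert (Hq : forall a b c d, s0 <= a -> a <= b -> b <= s1 -> t0 <= c -> c <= d -> d <= t1 ->
     b - a = (s1 - s0) / 2 -> d - c = (t1 - t0) / 2 ->
     Cmod (Phi a b c d) <= eps * (((s1 - s0) + (t1 - t0)) / 2) ^ 2).
  { intros a b c d Ha Hab Hb Hcc Hcd Hd E1 E2.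
    apply Rnot_lt_le. intros Hlt. apply Hno. exists ((a, b), (c, d)). simpl fst; simpl snd.
    split; [tauto|]. split. lra.
    replace (b - a + (d - c)) with (((s1 - s0) + (t1 - t0)) / 2) by lra. exact Hlt. }
  assert (E : Phi s0 s1 t0 t1 = (Phi s0 s t0 t + Phi s0 s t t1 + (Phi s s1 t0 t + Phi s s1 t t1))%C).
  { rewrite <- At by tauto. rewrite <- At by tauto. apply As; tauto. }
  rewrite E in Hbad.
  pose proof (Hq s0 s t0 t) as Q1. pose proof (Hq s0 s t t1) as Q2.
  pose proof (Hq s s1 t0 t) as Q3. pose proof (Hq s s1 t t1) as Q4.
  assert (s - s0 = (s1 - s0) / 2) by (unfold s; lra).
  assert (s1 - s = (s1 - s0) / 2) by (unfold s; lra).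
  assert (t - t0 = (t1 - t0) / 2) by (unfold t; lra).
  assert (t1 - t = (t1 - t0) / 2) by (unfold t; lra).
  specialize (Q1 ltac:(lra) ltac:(lra) ltac:(lra) ltac:(lra) ltac:(lra) ltac:(lra) ltac:(lra) ltac:(lra)).
  specialize (Q2 ltac:(lra) ltac:(lra) ltac:(lra) ltac:(lra) ltac:(lra) ltac:(lra) ltac:(lra) ltac:(lra)).
  specialize (Q3 ltac:(lra) ltac:(lra) ltac:(lra) ltac:(lra) ltac:(lra) ltac:(lra) ltac:(lra) ltac:(lra)).
  specialize (Q4 ltac:(lra) ltac:(lra) ltac:(lra) ltac:(lra) ltac:(lra) ltac:(lra) ltac:(lra) ltac:(lra)).
  pose proof (Cmod_triangle (Phi s0 s t0 t + Phi s0 s t t1) (Phi s s1 t0 t + Phi s s1 t t1)).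
  pose proof (Cmod_triangle (Phi s0 s t0 t) (Phi s0 s t t1)).
  pose proof (Cmod_triangle (Phi s s1 t0 t) (Phi s s1 t t1)).
  nra.
Qed.

(* Goursat's bisection argument, for an abstract additive rectangle function. *)
Lemma additive_rect_zero (Phi : R -> R -> R -> R -> C) (c : cell) :
  cell_sub c c ->
  (forall s0 s1 s2 t0 t1, cell_sub c ((s0, s1), (t0, t1)) -> cell_sub c ((s1, s2), (t0, t1)) ->
    Phi s0 s2 t0 t1 = (Phi s0 s1 t0 t1 + Phi s1 s2 t0 t1)%C) ->
  (forall s0 s1 t0 t1 t2, cell_sub c ((s0, s1), (t0, t1)) -> cell_sub c ((s0, s1), (t1, t2)) ->
    Phi s0 s1 t0 t2 = (Phi s0 s1 t0 t1 + Phi s0 s1 t1 t2)%C) ->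
  (forall eps u v, 0 < eps -> cell_mem c u v -> exists delta, 0 < delta /\
    forall s0 s1 t0 t1, cell_sub c ((s0, s1), (t0, t1)) -> cell_mem ((s0, s1), (t0, t1)) u v ->
      cell_size ((s0, s1), (t0, t1)) < delta ->
      Cmod (Phi s0 s1 t0 t1) <= eps * cell_size ((s0, s1), (t0, t1)) ^ 2) ->
  Phi (fst (fst c)) (snd (fst c)) (fst (snd c)) (snd (snd c)) = 0.
Proof.
  intros Hc As At Hloc.
  set (val := fun d : cell => Cmod (Phi (fst (fst d)) (snd (fst d)) (fst (snd d)) (snd (snd d)))).
  assert (Hall : forall eps, 0 < eps -> val c <= eps * cell_size c ^ 2).
  { intros eps He. apply Rnot_lt_le. intros Hbad.
    (* The hypotheses are placed under the existential so that choice yields a total [step], which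
       can be iterated; on cells that are not bad any value serves. *)
    assert (Hstep : forall d : cell, exists d' : cell,
      cell_sub c d -> eps * cell_size d ^ 2 < val d ->
      cell_sub d d' /\ cell_size d' = cell_size d / 2 /\ eps * cell_size d' ^ 2 < val d').
    { intros d. destruct (classic (cell_sub c d /\ eps * cell_size d ^ 2 < val d)) as [[H1 H2]|H].
      - destruct (additive_rect_bisect Phi eps d) as [d' Hd']; try exact H2.
        + unfold cell_sub in *; lra.
        + intros. apply As; unfold cell_sub in *; simpl in *; lra.
        + intros. apply At; unfold cell_sub in *; simpl in *; lra.
        + exists d'. intros _ _. exact Hd'.
      - exists d. intros; exfalso; tauto. }
    set (step := fun d => proj1_sig (constructive_indefinite_description _ (Hstep d))).
    assert (Hst : forall d, cell_sub c d -> eps * cell_size d ^ 2 < val d ->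
      cell_sub d (step d) /\ cell_size (step d) = cell_size d / 2 /\
      eps * cell_size (step d) ^ 2 < val (step d)).
    { intros d. exact (proj2_sig (constructive_indefinite_description _ (Hstep d))). }
    set (q := fun n => Nat.iter n step c).
    assert (Hq : forall n, cell_sub c (q n) /\ eps * cell_size (q n) ^ 2 < val (q n)
                 /\ cell_size (q n) = cell_size c / 2 ^ n).
    { induction n as [|n [I1 [I2 I3]]].
      - split; [exact Hc|]. split; [exact Hbad|]. simpl. field.
      - destruct (Hst (q n) I1 I2) as [J1 [J2 J3]].
        change (q (S n)) with (step (q n)).
        split. unfold cell_sub in *; lra. split. exact J3.
        rewrite J2, I3. simpl. field. apply pow_nonzero; lra. }
    assert (Hsub : forall n, cell_sub (q n) (q (S n))).
    { intros n. destruct (Hq n) as [I1 [I2 _]]. apply (Hst (q n) I1 I2). }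
    destruct (nested_intervals (fun n => fst (fst (q n))) (fun n => snd (fst (q n)))) as [u Hu];
      try (intros n; pose proof (Hsub n); pose proof (Hq n); unfold cell_sub in *; lra).
    destruct (nested_intervals (fun n => fst (snd (q n))) (fun n => snd (snd (q n)))) as [v Hv];
      try (intros n; pose proof (Hsub n); pose proof (Hq n); unfold cell_sub in *; lra).
    destruct (Hloc eps u v He) as [delta [Hd HD]].
    { split. apply (Hu O). apply (Hv O). }
    assert (Hlim : exists n, cell_size (q n) < delta).
    { assert (H2 : Rabs (/ 2) < 1) by (rewrite Rabs_pos_eq; lra).
      assert (Hsz : 0 <= cell_size c) by (unfold cell_size, cell_sub in *; lra).
      destruct (pow_lt_1_zero (/ 2) H2 (delta / (1 + cell_size c))) as [N HN].
      { apply Rdiv_lt_0_compat; lra. }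
      exists N. specialize (HN N (le_n _)). destruct (Hq N) as [_ [_ ->]].
      rewrite Rabs_pos_eq, pow_inv in HN by (apply pow_le; lra).
      apply (Rmult_lt_compat_r (1 + cell_size c)) in HN; [|lra].
      unfold Rdiv in HN. rewrite Rmult_assoc, Rinv_l, Rmult_1_r in HN by lra.
      assert (0 < / 2 ^ N) by (apply Rinv_0_lt_compat, pow_lt; lra).
      unfold Rdiv. nra. }
    destruct Hlim as [n Hn]. destruct (Hq n) as [I1 [I2 _]].
    specialize (HD (fst (fst (q n))) (snd (fst (q n))) (fst (snd (q n))) (snd (snd (q n)))).
    rewrite <- !surjective_pairing in HD.
    specialize (HD I1 (conj (Hu n) (Hv n)) Hn). unfold val in I2. lra. }
  apply Cmod_eq_0. apply Rle_antisym; [|apply Cmod_ge_0].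
  apply le_epsilon. intros eps He.
  assert (Hsz : 0 <= cell_size c ^ 2) by apply pow2_ge_0.
  eapply Rle_trans. apply (Hall (eps / (1 + cell_size c ^ 2))). apply Rdiv_lt_0_compat; lra.
  rewrite Rplus_0_l. apply (Rmult_le_reg_r (1 + cell_size c ^ 2)). lra.
  replace (eps / (1 + cell_size c ^ 2) * cell_size c ^ 2 * (1 + cell_size c ^ 2))
    with (eps * cell_size c ^ 2) by (field; lra). nra.
Qed.

(** The affine function [A + B (z - z0)] has the primitive [A (z - z0) + B/2 (z - z0)^2], so its
    path integral depends on the endpoints only; the remainder is at most [eta] and the speed at
    most [L]. *)
Lemma path_integral_affine_approx (F : C -> C) (gam dgam : R -> C) (a b L eta : R) (A B z0 : C) :
  a <= b -> 0 <= eta ->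
  (forall t, a <= t <= b -> Rderiv gam t (dgam t)) -> Rcont_on dgam a b ->
  (forall t, a <= t <= b -> Cmod (dgam t) <= L) ->
  (forall t, a <= t <= b -> Ccont F (gam t)) ->
  (forall t, a <= t <= b -> Cmod (F (gam t) - (A + B * (gam t - z0))) <= eta) ->
  Cmod (CInt (fun t => F (gam t) * dgam t)%C a b
        - ((A * (gam b - z0) + B / 2 * ((gam b - z0) * (gam b - z0)))
           - (A * (gam a - z0) + B / 2 * ((gam a - z0) * (gam a - z0))))) <= eta * L * (b - a).
Proof.
  intros Hab He Hd Hc HL HF Heta.
  assert (Cg : Rcont_on gam a b) by (intros t Ht; eapply Rcont_Rderiv; auto).
  assert (Cz : Rcont_on (fun t => gam t - z0)%C a b).
  { intros t Ht. apply Rcont_plus; auto. apply Rcont_const. }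
  assert (CF : Rcont_on (fun t => F (gam t) * dgam t)%C a b).
  { intros t Ht. apply Rcont_mult; auto. apply Rcont_comp; auto. }
  assert (CP : Rcont_on (fun t => (A + B * (gam t - z0)) * dgam t)%C a b).
  { intros t Ht. apply Rcont_mult; auto. apply Rcont_plus. apply Rcont_const.
    apply Rcont_mult; auto. apply Rcont_const. }
  rewrite <- (CInt_deriv (fun t => A * (gam t - z0) + B / 2 * ((gam t - z0) * (gam t - z0)))%C
                (fun t => (A + B * (gam t - z0)) * dgam t)%C a b); auto.
  - rewrite <- CInt_minus; auto.
    apply CInt_bound; auto.
    + intros t Ht. apply Rcont_minus; auto.
    + intros t Ht.
      replace (F (gam t) * dgam t - (A + B * (gam t - z0)) * dgam t)%C
        with ((F (gam t) - (A + B * (gam t - z0))) * dgam t)%C by ring.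
      rewrite Cmod_mult. apply Rmult_le_compat; auto; apply Cmod_ge_0.
  - intros t Ht.
    assert (Dz : Rderiv (fun t => gam t - z0)%C t (dgam t)).
    { replace (dgam t) with (dgam t + 0)%C by ring. apply Rderiv_plus; auto. apply Rderiv_const. }
    pose proof (Rderiv_plus _ _ t _ _ (Rderiv_mult _ _ t _ _ (Rderiv_const A t) Dz)
      (Rderiv_mult _ _ t _ _ (Rderiv_const (B / 2) t) (Rderiv_mult _ _ t _ _ Dz Dz))) as D.
    match type of D with Rderiv _ _ ?l =>
      replace ((A + B * (gam t - z0)) * dgam t)%C with l; [exact D|] end.
    field.
Qed.

(** The integral of [F dz] along the [Gam]-image of the rectangle's boundary, counterclockwise in
    the [(s, t)] plane; [dGs] and [dGt] stand for the partial derivatives of [Gam]. *)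
Definition boundary_integral (F : C -> C) (Gam dGs dGt : R -> R -> C) (s0 s1 t0 t1 : R) : C :=
  (CInt (fun t => F (Gam s1 t) * dGt s1 t) t0 t1
   - CInt (fun t => F (Gam s0 t) * dGt s0 t) t0 t1
   - (CInt (fun s => F (Gam s t1) * dGs s t1) s0 s1
      - CInt (fun s => F (Gam s t0) * dGs s t0) s0 s1))%C.

Lemma Cmod_sum4 (a b c d : C) (M : R) :
  Cmod a <= M -> Cmod b <= M -> Cmod c <= M -> Cmod d <= M ->
  Cmod (a - b - (c - d)) <= 4 * M.
Proof.
  intros Ha Hb Hc Hd.
  pose proof (Cmod_triangle (a - b) (- (c - d))) as H1.
  pose proof (Cmod_triangle a (- b)) as H2.
  pose proof (Cmod_triangle c (- d)) as H3.
  rewrite Cmod_opp in H1, H2, H3. unfold Cminus in *. lra.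
Qed.

(** Shared sides cancel, so the boundary integral is additive. On a small cell [F] is affine up to a
    small error; the values of the quadratic primitive at the four corners cancel, and only the
    error is left. *)
Lemma goursat_homotopy (F : C -> C) (Gam dGs dGt : R -> R -> C) (L : R) (c : cell) :
  1 <= L -> cell_sub c c ->
  (forall s t, cell_mem c s t -> Rderiv (fun x => Gam x t) s (dGs s t)) ->
  (forall s t, cell_mem c s t -> Rderiv (fun x => Gam s x) t (dGt s t)) ->
  (forall s t, cell_mem c s t -> Rcont (fun x => dGs x t) s) ->
  (forall s t, cell_mem c s t -> Rcont (fun x => dGt s x) t) ->
  (forall s t, cell_mem c s t -> Cmod (dGs s t) <= L) ->
  (forall s t, cell_mem c s t -> Cmod (dGt s t) <= L) ->
  (forall s t u v, cell_mem c s t -> cell_mem c u v ->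
     Cmod (Gam s t - Gam u v) <= L * (Rabs (s - u) + Rabs (t - v))) ->
  (forall s t, cell_mem c s t -> exists l, Cderiv F (Gam s t) l) ->
  boundary_integral F Gam dGs dGt (fst (fst c)) (snd (fst c)) (fst (snd c)) (snd (snd c)) = 0.
Proof.
  intros HL Hc Ds Dt Cs Ct Bs Bt Lip HF.
  assert (CF : forall s t, cell_mem c s t -> Ccont F (Gam s t)).
  { intros s t Hst. destruct (HF s t Hst) as [l Hl]. eapply Cderiv_cont; eauto. }
  assert (IS : forall s t, cell_mem c s t -> Rcont (fun x => F (Gam x t) * dGs x t)%C s).
  { intros s t Hst. apply Rcont_mult; auto. apply (Rcont_comp F (fun x => Gam x t)); auto.
    eapply Rcont_Rderiv. apply Ds; auto. }
  assert (IT : forall s t, cell_mem c s t -> Rcont (fun x => F (Gam s x) * dGt s x)%C t).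
  { intros s t Hst. apply Rcont_mult; auto. apply (Rcont_comp F (fun x => Gam s x)); auto.
    eapply Rcont_Rderiv. apply Dt; auto. }
  unfold cell_mem, cell_sub in *.
  apply (additive_rect_zero (boundary_integral F Gam dGs dGt) c); auto.
  - unfold cell_sub; simpl fst; simpl snd. intros s0 s1 s2 t0 t1 H1 H2.
    unfold boundary_integral.
    rewrite (CInt_Chasles (fun s => F (Gam s t1) * dGs s t1)%C s0 s1 s2),
      (CInt_Chasles (fun s => F (Gam s t0) * dGs s t0)%C s0 s1 s2).
    ring.
    all: try (split; lra). all: intros x Hx; apply IS; lra.
  - unfold cell_sub; simpl fst; simpl snd. intros s0 s1 t0 t1 t2 H1 H2.
    unfold boundary_integral.
    rewrite (CInt_Chasles (fun t => F (Gam s1 t) * dGt s1 t)%C t0 t1 t2),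
      (CInt_Chasles (fun t => F (Gam s0 t) * dGt s0 t)%C t0 t1 t2).
    ring.
    all: try (split; lra). all: intros x Hx; apply IT; lra.
  - unfold cell_sub, cell_mem, cell_size; simpl fst; simpl snd. intros eps u v He Huv.
    destruct (HF u v Huv) as [l Hl]. set (z0 := Gam u v) in *.
    assert (HL2 : 0 < L * L) by nra.
    (* Each of the four sides contributes at most [(e L sz) L sz]: the error of [F] times speed
       times length. The sum is [4 e L^2 sz^2 = eps sz^2]. *)
    set (e := eps / (4 * (L * L))).
    assert (Hep : 0 < e) by (apply Rdiv_lt_0_compat; lra).
    destruct (Hl e Hep) as [d [Hd Hdl]].
    exists (d / L). split. { apply Rdiv_lt_0_compat; lra. }
    intros s0 s1 t0 t1 Hcell Hmem Hsz.
    set (sz := s1 - s0 + (t1 - t0)) in *.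
    assert (Hsz0 : 0 <= sz) by (unfold sz; lra).
    assert (HLsz : L * sz < d).
    { apply (Rmult_lt_compat_l L) in Hsz; [|lra].
      replace (L * (d / L)) with d in Hsz by (field; lra). exact Hsz. }
    assert (Happ : forall s t, s0 <= s <= s1 -> t0 <= t <= t1 ->
       Cmod (F (Gam s t) - (F z0 + l * (Gam s t - z0))) <= e * (L * sz)).
    { intros s t Hs Ht.
      assert (Hz : Cmod (Gam s t - z0) <= L * sz).
      { eapply Rle_trans. apply Lip; try lra. apply Rmult_le_compat_l. lra.
        unfold sz. apply Rplus_le_compat; apply Rabs_le; lra. }
      replace (F (Gam s t) - (F z0 + l * (Gam s t - z0)))%C
        with (F (Gam s t) - F z0 - l * (Gam s t - z0))%C by ring.
      eapply Rle_trans. apply Hdl. lra. apply Rmult_le_compat_l; lra. }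
    set (Q := fun z => (F z0 * (z - z0) + l / 2 * ((z - z0) * (z - z0)))%C).
    assert (Heta : 0 <= e * (L * sz)) by (apply Rmult_le_pos; nra).
    assert (ET : forall s, s0 <= s <= s1 ->
      Cmod (CInt (fun t => F (Gam s t) * dGt s t)%C t0 t1 - (Q (Gam s t1) - Q (Gam s t0)))
        <= (e * (L * sz)) * L * sz).
    { intros s Hs. eapply Rle_trans.
      - apply (path_integral_affine_approx F (fun t => Gam s t) (fun t => dGt s t) t0 t1 L
          (e * (L * sz)) (F z0) l z0); try lra.
        all: try (intros t Ht). apply Dt; lra. apply Ct; lra. apply Bt; lra. apply CF; lra. apply Happ; lra.
      - apply Rmult_le_compat_l. nra. unfold sz; lra. }
    assert (ES : forall t, t0 <= t <= t1 ->
      Cmod (CInt (fun s => F (Gam s t) * dGs s t)%C s0 s1 - (Q (Gam s1 t) - Q (Gam s0 t)))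
        <= (e * (L * sz)) * L * sz).
    { intros t Ht. eapply Rle_trans.
      - apply (path_integral_affine_approx F (fun s => Gam s t) (fun s => dGs s t) s0 s1 L
          (e * (L * sz)) (F z0) l z0); try lra.
        all: try (intros s Hs). apply Ds; lra. apply Cs; lra. apply Bs; lra. apply CF; lra. apply Happ; lra.
      - apply Rmult_le_compat_l. nra. unfold sz; lra. }
    pose proof (Cmod_sum4 _ _ _ _ _ (ET s1 ltac:(lra)) (ET s0 ltac:(lra)) (ES t1 ltac:(lra)) (ES t0 ltac:(lra))) as H4.
    unfold boundary_integral.
    match goal with |- Cmod ?x <= _ => match type of H4 with Cmod ?y <= _ =>
      replace x with y by ring end end.
    eapply Rle_trans. exact H4. right. unfold e. field. lra.
Qed.

(** * Circles and Cauchy's formula *)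

Definition circ (r t : R) : C := (r * cos t, r * sin t).

Definition holo_on (R0 : R) (f : C -> C) : Prop :=
  forall z : C, Cmod z < R0 -> exists l, Cderiv f z l.

Lemma Cmod_circ (r t : R) : 0 <= r -> Cmod (circ r t) = r.
Proof.
  intros Hr. unfold Cmod, circ; simpl fst; simpl snd.
  replace ((r * cos t) ^ 2 + (r * sin t) ^ 2) with (r ^ 2).
  - now apply sqrt_pow2.
  - pose proof (sin2_cos2 t) as H. unfold Rsqr in H. nra.
Qed.

Lemma circ_2PI (r : R) : circ r (2 * PI) = circ r 0.
Proof. unfold circ. now rewrite cos_2PI, sin_2PI, cos_0, sin_0. Qed.

Lemma Rderiv_circ (r t : R) : Rderiv (circ r) t (Ci * circ r t)%C.
Proof.
  split; simpl; auto_derive; auto; ring.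
Qed.

Lemma Rcont_circ (r t : R) : Rcont (circ r) t.
Proof. eapply Rcont_Rderiv, Rderiv_circ. Qed.

Lemma circ_lipschitz (r t v : R) : 0 <= r -> Cmod (circ r t - circ r v) <= 2 * r * Rabs (t - v).
Proof.
  intros Hr. eapply Rle_trans. apply Cmod_le_Re_Im. simpl.
  replace (r * cos t + - (r * cos v)) with (r * (cos t - cos v)) by ring.
  replace (r * sin t + - (r * sin v)) with (r * (sin t - sin v)) by ring.
  rewrite !Rabs_mult, (Rabs_pos_eq r) by lra.
  assert (Rabs (cos t - cos v) <= 1 * Rabs (t - v)).
  { apply (bounded_variation cos (fun x => - sin x)). intros x _. split.
    - auto_derive; auto; ring.
    - rewrite Rabs_Ropp. apply Rabs_le. apply SIN_bound. }
  assert (Rabs (sin t - sin v) <= 1 * Rabs (t - v)).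
  { apply (bounded_variation sin cos). intros x _. split.
    - auto_derive; auto; ring.
    - apply Rabs_le. apply COS_bound. }
  nra.
Qed.

Lemma circ_minus_neq (a : C) (r t : R) : Cmod a < r -> (circ r t - a <> 0)%C.
Proof.
  intros Ha. pose proof (Cmod_ge_0 a). apply Cmod_gt_0.
  pose proof (Cmod_reverse_triangle (circ r t) a). rewrite Cmod_circ in H0 by lra. lra.
Qed.

(* The circles [a + s (circ r - a)] sweep from [|z| = r] down to the point [a], where the
   difference quotient is bounded but possibly not differentiable. *)
Lemma cauchy_difference_quotient (f : C -> C) (a : C) (r R0 : R) :
  Cmod a < r -> r < R0 -> holo_on R0 f ->
  CInt (fun t => (f (circ r t) - f a) / (circ r t - a) * circ r t)%C 0 (2 * PI) = 0.
Proof.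
  intros Ha Hr Hf. pose proof (Cmod_ge_0 a) as Ha0. pose proof PI_RGT_0 as HPI.
  set (F := fun z => ((f z - f a) / (z - a))%C).
  set (Gam := fun s t => (a + RtoC s * (circ r t - a))%C).
  set (dGs := fun s t : R => (circ r t - a)%C).
  set (dGt := fun s t => (RtoC s * (Ci * circ r t))%C).
  assert (HCs : forall s, 0 <= s -> Cmod (RtoC s) = s).
  { intros s Hs. rewrite Cmod_R. now apply Rabs_pos_eq. }
  assert (Hda : forall t, Cmod (circ r t - a) <= 2 * r).
  { intros t. eapply Rle_trans. apply (Cmod_triangle _ (- a)%C). rewrite Cmod_opp, Cmod_circ; lra. }
  assert (Hsub : forall s t, (Gam s t - a = RtoC s * (circ r t - a))%C).
  { intros. unfold Gam. ring. }
  assert (HF : forall s t, 0 < s <= 1 -> exists l, Cderiv F (Gam s t) l).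
  { intros s t Hs. destruct (Hf (Gam s t)) as [l Hl].
    - assert (E : Gam s t = (RtoC (1 - s) * a + RtoC s * circ r t)%C) by (unfold Gam; rewrite RtoC_minus; ring). rewrite E.
      eapply Rle_lt_trans. apply Cmod_triangle. rewrite !Cmod_mult, !HCs, Cmod_circ by lra. nra.
    - eexists. apply (Cderiv_div (fun z => f z - f a)%C (fun z => z - a)%C).
      + apply Cderiv_minus. exact Hl. apply Cderiv_const.
      + apply Cderiv_minus. apply Cderiv_id. apply Cderiv_const.
      + rewrite Hsub. apply Cmult_neq_0.
        * apply Cmod_gt_0. rewrite HCs; lra.
        * now apply circ_minus_neq. }
  (* The sides [t = 0] and [t = 2 PI] have the same image because the circle closes up, so they
     cancel and the integrals over the two bounding circles agree. *)
  assert (Hconst : forall eps, 0 < eps <= 1 ->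
     CInt (fun t => F (Gam 1 t) * dGt 1 t)%C 0 (2 * PI) = CInt (fun t => F (Gam eps t) * dGt eps t)%C 0 (2 * PI)).
  { intros eps He.
    (* [2 r] bounds [|circ r t - a|] and the Lipschitz constant of the circle; the added 1 meets the
       requirement [1 <= L]. *)
    pose proof (goursat_homotopy F Gam dGs dGt (2 * r + 1) ((eps, 1), (0, 2 * PI))) as G.
    unfold cell_mem, cell_sub in G; simpl fst in G; simpl snd in G.
    specialize (G ltac:(lra) ltac:(lra)).
    assert (E : boundary_integral F Gam dGs dGt eps 1 0 (2 * PI) = 0).
    { apply G; clear G.
      - intros s t Hst. unfold Gam, dGs.
        eapply Rderiv_eq.
        + apply Rderiv_plus. apply Rderiv_const. apply (Rderiv_mult RtoC (fun _ => circ r t - a)%C).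
          apply Rderiv_RtoC. apply Rderiv_const.
        + ring.
      - intros s t Hst. unfold Gam, dGt.
        eapply Rderiv_eq.
        + apply Rderiv_plus. apply Rderiv_const.
          apply (Rderiv_mult (fun _ => RtoC s) (fun t => circ r t + - a)%C).
          apply Rderiv_const. apply Rderiv_plus. apply Rderiv_circ. apply Rderiv_const.
        + ring.
      - intros s t Hst. apply (Rcont_const (circ r t - a)%C).
      - intros s t Hst. unfold dGt. repeat apply Rcont_mult; try apply Rcont_const. apply Rcont_circ.
      - intros s t Hst. unfold dGs. specialize (Hda t). lra.
      - intros s t Hst. unfold dGt. rewrite !Cmod_mult, Cmod_Ci, HCs, Cmod_circ by lra. nra.
      - intros s t u v Hst Huv.
        replace (Gam s t - Gam u v)%C
          with (RtoC (s - u) * (circ r t - a) + RtoC u * (circ r t - circ r v))%C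
          by (unfold Gam; rewrite RtoC_minus; ring).
        eapply Rle_trans. apply Cmod_triangle. rewrite !Cmod_mult, (HCs u), Cmod_R by lra.
        pose proof (circ_lipschitz r t v ltac:(lra)) as Hl. specialize (Hda t).
        pose proof (Rabs_pos (s - u)). pose proof (Rabs_pos (t - v)).
        pose proof (Cmod_ge_0 (circ r t - circ r v)).
        assert (Rabs (s - u) * Cmod (circ r t - a) <= Rabs (s - u) * (2 * r)) by (apply Rmult_le_compat_l; lra).
        assert (u * Cmod (circ r t - circ r v) <= 1 * Cmod (circ r t - circ r v)) by (apply Rmult_le_compat_r; lra).
        nra.
      - intros s t Hst. apply HF; lra. }
    unfold boundary_integral in E.
    assert (EV : CInt (fun s => F (Gam s (2 * PI)%R) * dGs s (2 * PI)%R)%C eps 1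
               = CInt (fun s => F (Gam s 0) * dGs s 0)%C eps 1).
    { unfold Gam, dGs. now rewrite circ_2PI. }
    rewrite EV in E.
    match type of E with (?x - ?y - (?z - ?z))%C = _ =>
      replace x with (x - y - (z - z) + y)%C by ring end.
    rewrite E. ring. }
  assert (HA : CInt (fun t => F (Gam 1 t) * dGt 1 t)%C 0 (2 * PI) = 0).
  { apply Cmod_eq_0. apply Rle_antisym; [|apply Cmod_ge_0].
    destruct (Hf a) as [l Hl]. lra.
    destruct (Hl 1 Rlt_0_1) as [d [Hd Hdl]].
    pose proof (Cmod_ge_0 l) as Hl0.
    apply le_epsilon. intros e He. rewrite Rplus_0_l.
    set (K := (Cmod l + 1) * r * (2 * PI)).
    assert (HK : 0 < K) by (unfold K; apply Rmult_lt_0_compat; [apply Rmult_lt_0_compat|]; lra).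
    (* [d / (4 r)] puts the circle within [d] of [a], where [|F| <= |l| + 1]. The integral over it
       is then at most [(|l| + 1) eps r 2 PI = eps K <= e]. *)
    set (eps := Rmin (1 / 2) (Rmin (d / (4 * r)) (e / K))).
    assert (Hep : 0 < eps).
    { unfold eps. repeat apply Rmin_pos; try lra; apply Rdiv_lt_0_compat; lra. }
    assert (Hep1 : eps <= 1 / 2) by apply Rmin_l.
    assert (Hep2 : eps <= d / (4 * r)) by (unfold eps; eapply Rle_trans; [apply Rmin_r|apply Rmin_l]).
    assert (Hep3 : eps <= e / K) by (unfold eps; eapply Rle_trans; [apply Rmin_r|apply Rmin_r]).
    rewrite (Hconst eps) by (split; lra).
    eapply Rle_trans. apply (CInt_bound _ _ _ ((Cmod l + 1) * (eps * r))).
    - lra.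
    - intros t Ht. apply Rcont_mult.
      + apply (Rcont_comp F (fun t => Gam eps t)).
        * destruct (HF eps t) as [l' Hl']. lra. eapply Cderiv_cont; eauto.
        * unfold Gam. apply Rcont_plus. apply Rcont_const. apply Rcont_mult. apply Rcont_const.
          apply Rcont_minus. apply Rcont_circ. apply Rcont_const.
      + unfold dGt. repeat apply Rcont_mult; try apply Rcont_const. apply Rcont_circ.
    - intros t Ht. rewrite Cmod_mult. apply Rmult_le_compat; try apply Cmod_ge_0.
      + assert (Hz : (Gam eps t - a)%C <> 0).
        { rewrite Hsub. apply Cmult_neq_0.
          apply Cmod_gt_0. rewrite HCs; lra. now apply circ_minus_neq. }
        assert (Hz' := proj1 (Cmod_gt_0 _) Hz).
        assert (Hzd : Cmod (Gam eps t - a) < d).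
        { rewrite Hsub, Cmod_mult, HCs by lra. specialize (Hda t).
          apply (Rmult_le_compat_r (4 * r)) in Hep2; [|lra].
          replace (d / (4 * r) * (4 * r)) with d in Hep2 by (field; lra).
          pose proof (Cmod_ge_0 (circ r t - a)). nra. }
        specialize (Hdl _ Hzd).
        unfold F. rewrite Cmod_div by auto. apply (Rmult_le_reg_r (Cmod (Gam eps t - a))). lra.
        unfold Rdiv. rewrite Rmult_assoc, Rinv_l, Rmult_1_r by lra.
        replace (f (Gam eps t) - f a)%C
          with ((f (Gam eps t) - f a - l * (Gam eps t - a)) + l * (Gam eps t - a))%C by ring.
        eapply Rle_trans. apply Cmod_triangle. rewrite Cmod_mult. lra.
      + unfold dGt. rewrite !Cmod_mult, Cmod_Ci, HCs, Cmod_circ by lra. lra.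
    - apply (Rmult_le_compat_r K) in Hep3; [|lra].
      replace (e / K * K) with e in Hep3 by (field; lra). unfold K in Hep3. lra. }
  assert (Cint : Rcont_on (fun t => F (circ r t) * circ r t)%C 0 (2 * PI)).
  { intros t Ht. apply Rcont_mult; [|apply Rcont_circ]. apply Rcont_comp; [|apply Rcont_circ].
    destruct (HF 1 t) as [l' Hl']. lra. apply (Cderiv_cont F _ l').
    replace (circ r t) with (Gam 1 t); auto. unfold Gam. ring. }
  rewrite (CInt_ext _ (fun t => Ci * (F (circ r t) * circ r t))%C) in HA; [|lra|].
  - rewrite CInt_scal in HA; auto; [|lra].
    change (CInt (fun t => F (circ r t) * circ r t)%C 0 (2 * PI) = 0).
    assert (HCi : Ci <> 0). { apply Cmod_gt_0. rewrite Cmod_Ci. lra. }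
    replace (CInt (fun t => F (circ r t) * circ r t)%C 0 (2 * PI))
      with (/ Ci * (Ci * CInt (fun t => F (circ r t) * circ r t)%C 0 (2 * PI)))%C by (field; auto).
    rewrite HA. ring.
  - intros t Ht. unfold dGt. replace (Gam 1 t) with (circ r t) by (unfold Gam; ring). ring.
Qed.

(** With [a = 0] the integrand of [cauchy_difference_quotient] collapses to [f (circ r t) - f 0]. *)
Lemma mean_value_property (f : C -> C) (r R0 : R) :
  0 < r -> r < R0 -> holo_on R0 f ->
  CInt (fun t => f (circ r t)) 0 (2 * PI) = (2 * PI * f (RtoC 0%R))%C.
Proof.
  intros Hr HR Hf. pose proof PI_RGT_0 as HPI.
  assert (H0 : Cmod 0 < r) by (rewrite Cmod_0; lra).
  pose proof (cauchy_difference_quotient f 0 r R0 H0 HR Hf) as H.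
  assert (Cf : Rcont_on (fun t => f (circ r t)) 0 (2 * PI)).
  { intros t Ht. apply Rcont_comp; [|apply Rcont_circ].
    destruct (Hf (circ r t)) as [l Hl]. rewrite Cmod_circ; lra. eapply Cderiv_cont; eauto. }
  rewrite (CInt_ext _ (fun t => f (circ r t) - f 0)%C) in H; [|lra|].
  - rewrite CInt_minus, CInt_const in H; try lra; auto; [|intros t _; apply Rcont_const].
    match type of H with (?x - _)%C = _ => replace x with (x - RtoC (2 * PI - 0) * f 0 + RtoC (2 * PI - 0) * f 0)%C by ring end.
    rewrite H, Rminus_0_r, RtoC_mult. ring.
  - intros t _. field. pose proof (circ_minus_neq 0 r t H0) as H1.
    intros E. apply H1. rewrite E. ring.
Qed.

(* The conjugate of the integrand is a holomorphic function of [circ r t],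
   because [Cconj z = r^2 / z] on the circle. *)
Lemma cauchy_kernel_integral (a : C) (r : R) :
  Cmod a < r -> CInt (fun t => circ r t / (circ r t - a))%C 0 (2 * PI) = RtoC (2 * PI).
Proof.
  intros Ha. pose proof (Cmod_ge_0 a) as Ha0. pose proof PI_RGT_0 as HPI.
  set (k := fun z => (RtoC (r ^ 2) / (RtoC (r ^ 2) - Cconj a * z))%C).
  (* [|a| (2 r - |a|) = r^2 - (r - |a|)^2 < r^2]; the radius [2 r - |a|] exceeds [r], as the mean
     value property requires. *)
  assert (Hden : forall z, Cmod z < 2 * r - Cmod a -> (RtoC (r ^ 2) - Cconj a * z)%C <> 0).
  { intros z Hz. apply Cmod_gt_0.
    pose proof (Cmod_reverse_triangle (RtoC (r ^ 2)) (Cconj a * z)) as H.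
    rewrite Cmod_mult, Cmod_conj, Cmod_R, Rabs_pos_eq in H by (apply pow2_ge_0).
    assert (Cmod a * Cmod z <= Cmod a * (2 * r - Cmod a)) by (apply Rmult_le_compat_l; lra).
    assert (0 < (r - Cmod a) * (r - Cmod a)) by (apply Rmult_lt_0_compat; lra). nra. }
  assert (Hk : holo_on (2 * r - Cmod a) k).
  { intros z Hz. eexists. apply (Cderiv_div (fun _ => RtoC (r ^ 2)) (fun z => RtoC (r ^ 2) - Cconj a * z)%C).
    - apply Cderiv_const.
    - apply Cderiv_minus. apply Cderiv_const. apply (Cderiv_mult (fun _ => Cconj a) (fun z => z)).
      apply Cderiv_const. apply Cderiv_id.
    - auto. }
  pose proof (mean_value_property k r (2 * r - Cmod a) ltac:(lra) ltac:(lra) Hk) as M.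
  assert (Hr2 : RtoC (r ^ 2) <> 0). { apply Cmod_gt_0. rewrite Cmod_R. apply Rabs_pos_lt, pow_nonzero. lra. }
  assert (k0 : k 0 = 1). { unfold k. field. auto. }
  rewrite k0 in M.
  assert (Ck : Rcont_on (fun t => k (circ r t)) 0 (2 * PI)).
  { intros t _. apply Rcont_comp; [|apply Rcont_circ].
    destruct (Hk (circ r t)) as [l Hl]. rewrite Cmod_circ; lra. eapply Cderiv_cont; eauto. }
  rewrite (CInt_ext _ (fun t => Cconj (k (circ r t)))); [|lra|].
  - rewrite CInt_conj, M by (auto; lra). unfold Cconj, Cmult, RtoC; simpl. f_equal; ring.
  - intros t _.
    assert (E2 : (circ r t * Cconj (circ r t))%C = RtoC (r ^ 2)).
    { rewrite <- Cmod2_conj, Cmod_circ by lra. reflexivity. }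
    assert (Hd := Hden (circ r t)). rewrite Cmod_circ in Hd by lra. specialize (Hd ltac:(lra)).
    unfold k. rewrite Cdiv_conj, Cminus_conj, Cmult_conj, Cconj_conj by auto.
    assert (E3 : Cconj (RtoC (r ^ 2)) = RtoC (r ^ 2)) by (unfold Cconj, RtoC; simpl; f_equal; ring).
    rewrite E3, <- E2.
    pose proof (circ_minus_neq a r t Ha) as N1.
    assert (N2 : Cconj (circ r t) <> 0). { apply Cmod_gt_0. rewrite Cmod_conj, Cmod_circ; lra. }
    field. split; auto. replace (circ r t * Cconj (circ r t) - a * Cconj (circ r t))%C
      with ((circ r t - a) * Cconj (circ r t))%C by ring. now apply Cmult_neq_0.
Qed.

(** The vanishing integral of the difference quotient splits into the wanted integral minus [f a]
    times the kernel integral. *)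
Lemma cauchy_formula (f : C -> C) (a : C) (r R0 : R) :
  Cmod a < r -> r < R0 -> holo_on R0 f ->
  CInt (fun t => f (circ r t) * circ r t / (circ r t - a))%C 0 (2 * PI) = (2 * PI * f a)%C.
Proof.
  intros Ha Hr Hf. pose proof (Cmod_ge_0 a) as Ha0. pose proof PI_RGT_0 as HPI.
  pose proof (cauchy_difference_quotient f a r R0 Ha Hr Hf) as H.
  assert (Ci : forall t, Rcont (fun t => / (circ r t - a))%C t).
  { intros t. apply (Rcont_comp Cinv (fun t => circ r t - a)%C).
    eapply Cderiv_cont, Cderiv_inv, circ_minus_neq; auto.
    apply Rcont_minus. apply Rcont_circ. apply Rcont_const. }
  assert (Cf : forall t, Rcont (fun t => f (circ r t)) t).
  { intros t. apply Rcont_comp; [|apply Rcont_circ].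
    destruct (Hf (circ r t)) as [l Hl]. rewrite Cmod_circ; lra. eapply Cderiv_cont; eauto. }
  assert (Cz : forall t, Rcont (circ r) t) by apply Rcont_circ.
  rewrite (CInt_ext _ (fun t => f (circ r t) * circ r t / (circ r t - a)
                        - f a * (circ r t / (circ r t - a)))%C) in H; [|lra|].
  - rewrite CInt_minus, CInt_scal, cauchy_kernel_integral in H; auto; try lra.
    + match type of H with (?x - ?y)%C = _ => replace x with (x - y + y)%C by ring end.
      rewrite H, RtoC_mult. ring.
    + intros t _. apply Rcont_mult; auto.
    + intros t _. repeat apply Rcont_mult; auto.
    + intros t _. repeat apply Rcont_mult; auto. apply Rcont_const.
  - intros t _. field. now apply circ_minus_neq.
Qed.

(** * Consequences of the Cauchy formula *)

Lemma Rcont_on_bounded (u : R -> C) (a b : R) :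
  a <= b -> Rcont_on u a b -> exists M, 0 <= M /\ forall t, a <= t <= b -> Cmod (u t) <= M.
Proof.
  intros Hab Hu.
  destruct (continuity_ab_maj (fun t => Cmod (u t)) a b Hab) as [m [Hm _]].
  - intros t Ht eps He. destruct (Hu t Ht eps He) as [d [Hd Hd2]].
    exists d. split; auto. intros x [_ Hx]. specialize (Hd2 x Hx).
    eapply Rle_lt_trans; [|exact Hd2]. simpl. unfold R_dist. apply Rabs_le. split.
    + pose proof (Cmod_reverse_triangle (u t) (u x)) as H. rewrite Cmod_minus_sym in H. lra.
    + apply Cmod_reverse_triangle.
  - exists (Cmod (u m)). split; [apply Cmod_ge_0|auto].
Qed.

Lemma Cderiv_unique (f : C -> C) (z a b : C) : Cderiv f z a -> Cderiv f z b -> a = b.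
Proof.
  intros Ha Hb.
  assert (H : (a - b)%C = 0).
  { apply Cmod_eq_0. apply Rle_antisym; [|apply Cmod_ge_0].
    apply le_epsilon. intros e He. rewrite Rplus_0_l.
    destruct (Ha (e / 2)) as [d1 [Hd1 H1]]. lra.
    destruct (Hb (e / 2)) as [d2 [Hd2 H2]]. lra.
    set (d := Rmin d1 d2 / 2). assert (0 < Rmin d1 d2) by now apply Rmin_pos.
    pose proof (Rmin_l d1 d2). pose proof (Rmin_r d1 d2).
    assert (Hd : Cmod (z + RtoC d - z) = d).
    { replace (z + RtoC d - z)%C with (RtoC d) by ring. rewrite Cmod_R, Rabs_pos_eq; unfold d; lra. }
    specialize (H1 (z + RtoC d)%C). specialize (H2 (z + RtoC d)%C). rewrite Hd in H1, H2.
    specialize (H1 ltac:(unfold d; lra)). specialize (H2 ltac:(unfold d; lra)).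
    set (x := (f (z + RtoC d) - f z)%C) in *.
    pose proof (Cmod_triangle (x - b * (z + RtoC d - z)) (- (x - a * (z + RtoC d - z)))) as T.
    rewrite Cmod_opp in T.
    replace (x - b * (z + RtoC d - z) + - (x - a * (z + RtoC d - z)))%C
      with ((a - b) * (z + RtoC d - z))%C in T by ring.
    rewrite Cmod_mult, Hd in T.
    apply (Rmult_le_reg_r d). unfold d; lra. lra. }
  replace a with (a - b + b)%C by ring. rewrite H. ring.
Qed.

(** A remainder that is quadratic in [b - a], uniformly in [t], stays quadratic after integration;
    no limit theorem for integrals is involved. *)
Lemma Cderiv_under_integral (K : C -> R -> C) (dK : R -> C) (a : C) (d0 M s0 s1 : R) :
  0 < d0 -> 0 <= M -> s0 <= s1 ->
  (forall b, Cmod (b - a) < d0 -> Rcont_on (K b) s0 s1) -> Rcont_on dK s0 s1 ->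
  (forall b t, Cmod (b - a) < d0 -> s0 <= t <= s1 ->
     Cmod (K b t - K a t - dK t * (b - a)) <= M * Cmod (b - a) ^ 2) ->
  Cderiv (fun b => CInt (K b) s0 s1) a (CInt dK s0 s1).
Proof.
  intros Hd0 HM Hs HK HdK Hest eps He.
  set (A := 1 + M * (s1 - s0)).
  assert (HA : 1 <= A) by (unfold A; nra).
  exists (Rmin d0 (eps / A)). split. { apply Rmin_pos; auto. apply Rdiv_lt_0_compat; lra. }
  intros b Hb.
  assert (Hb1 := Rlt_le_trans _ _ _ Hb (Rmin_l _ _)).
  assert (Hb2 := Rlt_le_trans _ _ _ Hb (Rmin_r _ _)).
  assert (Haa : Cmod (a - a) < d0). { replace (a - a)%C with (RtoC 0) by ring. now rewrite Cmod_0. }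
  assert (HdK2 : Rcont_on (fun t => (b - a) * dK t)%C s0 s1).
  { intros t Ht. apply Rcont_mult; auto. apply Rcont_const. }
  replace (CInt dK s0 s1 * (b - a))%C with ((b - a) * CInt dK s0 s1)%C by ring.
  rewrite <- CInt_scal, <- CInt_minus, <- CInt_minus; auto.
  - eapply Rle_trans. apply (CInt_bound _ _ _ (M * Cmod (b - a) ^ 2)); auto.
    + intros t Ht. repeat apply Rcont_minus; auto; apply HK; auto.
    + intros t Ht. replace ((b - a) * dK t)%C with (dK t * (b - a))%C by ring. auto.
    + apply (Rmult_lt_compat_r A) in Hb2; [|lra].
      replace (eps / A * A) with eps in Hb2 by (field; lra).
      pose proof (Cmod_ge_0 (b - a)) as H0.
      assert (M * (s1 - s0) <= A) by (unfold A; lra).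
      replace (M * Cmod (b - a) ^ 2 * (s1 - s0)) with ((Cmod (b - a) * (M * (s1 - s0))) * Cmod (b - a)) by ring.
      apply Rmult_le_compat_r; auto. nra.
  - intros t Ht. apply Rcont_minus; apply HK; auto.
Qed.

(** Using half of the gap between [a] and the circle gives one lower bound for a whole neighbourhood
    of [a], hence uniform remainders for the Cauchy kernels. *)
Lemma circ_minus_lower (a b : C) (r t : R) :
  Cmod a < r -> Cmod (b - a) < (r - Cmod a) / 2 -> (r - Cmod a) / 2 <= Cmod (circ r t - b).
Proof.
  intros Ha Hb. pose proof (Cmod_ge_0 a).
  pose proof (Cmod_reverse_triangle (circ r t) b) as H1. rewrite Cmod_circ in H1 by lra.
  pose proof (Cmod_reverse_triangle b a). lra.
Qed.

Lemma Rcont_inv_circ_minus (a : C) (r t : R) :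
  Cmod a < r -> Rcont (fun t => / (circ r t - a))%C t.
Proof.
  intros Ha. apply (Rcont_comp Cinv (fun t => circ r t - a)%C).
  - eapply Cderiv_cont, Cderiv_inv, circ_minus_neq; auto.
  - apply Rcont_minus. apply Rcont_circ. apply Rcont_const.
Qed.

(** The density [u] is any continuous function, since different densities are needed later. With
    [x = circ r t - a] and [y = circ r t - b] the remainder is [u (x - y)^2 / (x^2 y)], at most
    [U / d^3] times [|b - a|^2]. *)
Lemma Cderiv_cauchy_kernel (u : R -> C) (a : C) (r : R) :
  Cmod a < r -> Rcont_on u 0 (2 * PI) ->
  Cderiv (fun b => CInt (fun t => u t / (circ r t - b))%C 0 (2 * PI)) a
    (CInt (fun t => u t / (circ r t - a) / (circ r t - a))%C 0 (2 * PI)).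
Proof.
  intros Ha Hu. pose proof PI_RGT_0 as HPI.
  destruct (Rcont_on_bounded u 0 (2 * PI) ltac:(lra) Hu) as [U [HU0 HU]].
  set (d := (r - Cmod a) / 2). assert (Hd : 0 < d) by (unfold d; lra).
  assert (Hlt : forall b, Cmod (b - a) < d -> Cmod b < r).
  { intros b Hb. pose proof (Cmod_reverse_triangle b a). unfold d in Hb. lra. }
  assert (Haa : Cmod (a - a) < d). { replace (a - a)%C with (RtoC 0) by ring. now rewrite Cmod_0. }
  apply (Cderiv_under_integral (fun b t => u t / (circ r t - b))%C _ a d (U * / d ^ 3)); auto; try lra.
  - apply Rmult_le_pos; auto. apply Rlt_le, Rinv_0_lt_compat, pow_lt; auto.
  - intros b Hb t Ht. apply Rcont_mult; auto. apply Rcont_inv_circ_minus; auto.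
  - intros t Ht. repeat apply Rcont_mult; auto; apply Rcont_inv_circ_minus; auto.
  - intros b t Hb Ht.
    pose proof (circ_minus_lower a a r t Ha Haa) as L1.
    pose proof (circ_minus_lower a b r t Ha Hb) as L2. fold d in L1, L2.
    pose proof (circ_minus_neq a r t Ha) as N1.
    pose proof (circ_minus_neq b r t (Hlt b Hb)) as N2.
    set (x := (circ r t - a)%C) in *. set (y := (circ r t - b)%C) in *.
    replace (b - a)%C with (x - y)%C by (unfold x, y; ring).
    replace (u t / y - u t / x - u t / x / x * (x - y))%C
      with (u t * ((x - y) * (x - y) * / (x * x * y)))%C by (field; auto).
    assert (N3 : (x * x * y)%C <> 0) by (repeat apply Cmult_neq_0; auto).
    rewrite !Cmod_mult, Cmod_inv, !Cmod_mult by auto.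
    assert (I1 : 0 < / (Cmod x * Cmod x * Cmod y)).
    { apply Rinv_0_lt_compat. apply Rmult_lt_0_compat; [apply Rmult_lt_0_compat|]; lra. }
    assert (I2 : / (Cmod x * Cmod x * Cmod y) <= / d ^ 3).
    { apply Rinv_le_contravar. now apply pow_lt.
      replace (d ^ 3) with (d * d * d) by ring.
      apply Rmult_le_compat; try lra; [nra|apply Rmult_le_compat; lra]. }
    assert (I3 : Cmod (u t) * / (Cmod x * Cmod x * Cmod y) <= U * / d ^ 3).
    { apply Rmult_le_compat; auto. apply Cmod_ge_0. lra. }
    pose proof (Cmod_ge_0 (x - y)).
    apply (Rmult_le_compat_r (Cmod (x - y) * Cmod (x - y))) in I3; [|nra].
    lra.
Qed.

(** Here the remainder is [u (x - y)^2 (1 / (x^2 y^2) + 2 / (x^3 y))], which accounts for the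
    constant [3 / d^4]. *)
Lemma Cderiv_cauchy_kernel_sqr (u : R -> C) (a : C) (r : R) :
  Cmod a < r -> Rcont_on u 0 (2 * PI) ->
  exists l, Cderiv (fun b => CInt (fun t => u t / (circ r t - b) / (circ r t - b))%C 0 (2 * PI)) a l.
Proof.
  intros Ha Hu. pose proof PI_RGT_0 as HPI.
  destruct (Rcont_on_bounded u 0 (2 * PI) ltac:(lra) Hu) as [U [HU0 HU]].
  set (d := (r - Cmod a) / 2). assert (Hd : 0 < d) by (unfold d; lra).
  assert (Hlt : forall b, Cmod (b - a) < d -> Cmod b < r).
  { intros b Hb. pose proof (Cmod_reverse_triangle b a). unfold d in Hb. lra. }
  assert (Haa : Cmod (a - a) < d). { replace (a - a)%C with (RtoC 0) by ring. now rewrite Cmod_0. }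
  assert (Hid : 0 < / d) by now apply Rinv_0_lt_compat.
  exists (CInt (fun t => 2 * (u t / (circ r t - a) / (circ r t - a) / (circ r t - a)))%C 0 (2 * PI)).
  apply (Cderiv_under_integral (fun b t => u t / (circ r t - b) / (circ r t - b))%C _ a d (U * (3 * (/ d) ^ 4)));
    auto; try lra.
  - apply Rmult_le_pos; auto. apply Rmult_le_pos. lra. apply pow_le. lra.
  - intros b Hb t Ht. repeat apply Rcont_mult; auto; apply Rcont_inv_circ_minus; auto.
  - intros t Ht. apply Rcont_mult. apply Rcont_const.
    repeat apply Rcont_mult; auto; apply Rcont_inv_circ_minus; auto.
  - intros b t Hb Ht.
    pose proof (circ_minus_lower a a r t Ha Haa) as L1.
    pose proof (circ_minus_lower a b r t Ha Hb) as L2. fold d in L1, L2.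
    pose proof (circ_minus_neq a r t Ha) as N1.
    pose proof (circ_minus_neq b r t (Hlt b Hb)) as N2.
    set (x := (circ r t - a)%C) in *. set (y := (circ r t - b)%C) in *.
    replace (b - a)%C with (x - y)%C by (unfold x, y; ring).
    replace (u t / y / y - u t / x / x - 2 * (u t / x / x / x) * (x - y))%C
      with (u t * ((/ x * / x * (/ y * / y) + 2 * (/ x * / x * (/ x * / y))) * ((x - y) * (x - y))))%C
      by (field; auto).
    rewrite !Cmod_mult.
    assert (I3 : Cmod (u t) * Cmod (/ x * / x * (/ y * / y) + 2 * (/ x * / x * (/ x * / y)))
                 <= U * (3 * (/ d) ^ 4)).
    { apply Rmult_le_compat; auto; try apply Cmod_ge_0.
      eapply Rle_trans. apply Cmod_triangle. rewrite !Cmod_mult, !Cmod_inv by auto.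
      rewrite Cmod_R, Rabs_pos_eq by lra.
      assert (I1 : 0 <= / Cmod x <= / d).
      { split. apply Rlt_le, Rinv_0_lt_compat; lra. apply Rinv_le_contravar; lra. }
      assert (I2 : 0 <= / Cmod y <= / d).
      { split. apply Rlt_le, Rinv_0_lt_compat; lra. apply Rinv_le_contravar; lra. }
      set (p := / Cmod x) in *. set (q := / Cmod y) in *. set (e := / d) in *.
      assert (pp : 0 <= p * p <= e * e) by (split; [nra|apply Rmult_le_compat; lra]).
      assert (qq : 0 <= q * q <= e * e) by (split; [nra|apply Rmult_le_compat; lra]).
      assert (pq : 0 <= p * q <= e * e) by (split; [nra|apply Rmult_le_compat; lra]).
      assert (p * p * (q * q) <= e * e * (e * e)) by (apply Rmult_le_compat; lra).
      assert (p * p * (p * q) <= e * e * (e * e)) by (apply Rmult_le_compat; lra).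
      lra. }
    pose proof (Cmod_ge_0 (x - y)).
    apply (Rmult_le_compat_r (Cmod (x - y) * Cmod (x - y))) in I3; [|nra].
    lra.
Qed.

Lemma Rcont_on_circ (f : C -> C) (r R0 a b : R) :
  0 <= r < R0 -> holo_on R0 f -> Rcont_on (fun t => f (circ r t)) a b.
Proof.
  intros Hr Hf t _. apply Rcont_comp; [|apply Rcont_circ].
  destruct (Hf (circ r t)) as [l Hl]. rewrite Cmod_circ; lra. eapply Cderiv_cont; eauto.
Qed.

Lemma RtoC_2PI_neq_0 : (2 * PI)%C <> 0.
Proof.
  pose proof PI_RGT_0. apply Cmod_gt_0. rewrite Cmod_mult, !Cmod_R, !Rabs_pos_eq; lra.
Qed.

(** Both sides are the derivative of [2 PI f] at [a]: one by differentiating Cauchy's formula under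
    the integral, the other directly. *)
Lemma cauchy_formula_deriv (f : C -> C) (a l : C) (r R0 : R) :
  Cmod a < r -> r < R0 -> holo_on R0 f -> Cderiv f a l ->
  (CInt (fun t => f (circ r t) * circ r t / (circ r t - a) / (circ r t - a))%C 0 (2 * PI)
    = 2 * PI * l)%C.
Proof.
  intros Ha Hr Hf Hl. pose proof (Cmod_ge_0 a).
  apply (Cderiv_unique (fun b => 2 * PI * f b)%C a).
  - apply (Cderiv_ext_loc (fun b => CInt (fun t => f (circ r t) * circ r t / (circ r t - b))%C 0 (2 * PI)) _ _ _ (r - Cmod a)).
    + lra.
    + intros b Hb. apply cauchy_formula with R0; auto.
      pose proof (Cmod_reverse_triangle b a). lra.
    + apply (Cderiv_cauchy_kernel (fun t => f (circ r t) * circ r t)%C); auto.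
      intros t Ht. apply Rcont_mult; [|apply Rcont_circ].
      apply (Rcont_on_circ f r R0 0 (2 * PI)); auto. lra.
  - eapply Cderiv_eq. apply (Cderiv_mult (fun _ => (2 * PI)%C)). apply Cderiv_const. exact Hl. ring.
Qed.

(** Near [z] the derivative equals an integral against the squared Cauchy kernel, which is itself
    differentiable. *)
Lemma holo_on_deriv (f df : C -> C) (R0 : R) :
  (forall z, Cmod z < R0 -> Cderiv f z (df z)) -> holo_on R0 df.
Proof.
  intros Hf z Hz. pose proof (Cmod_ge_0 z).
  assert (Hh : holo_on R0 f) by (intros w Hw; exists (df w); auto).
  set (r := (Cmod z + R0) / 2).
  destruct (Cderiv_cauchy_kernel_sqr (fun t => f (circ r t) * circ r t)%C z r) as [l Hl].
  - unfold r; lra.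
  - intros t Ht. apply Rcont_mult; [|apply Rcont_circ].
    apply (Rcont_on_circ f r R0 0 (2 * PI)); auto. unfold r; lra.
  - eexists.
    eapply (Cderiv_ext_loc (fun w => / (2 * PI) *
       CInt (fun t => f (circ r t) * circ r t / (circ r t - w) / (circ r t - w)) 0 (2 * PI)%R)%C _ _ _ (r - Cmod z)).
    + unfold r; lra.
    + intros w Hw.
      assert (Cmod w < r) by (pose proof (Cmod_reverse_triangle w z); lra).
      assert (r < R0) by (unfold r; lra).
      rewrite (cauchy_formula_deriv f w (df w) r R0); auto.
      * field. intros E. apply RtoC_2PI_neq_0. rewrite E. ring.
      * apply Hf. lra.
    + apply (Cderiv_mult (fun _ => / (2 * PI))%C). apply Cderiv_const. exact Hl.
Qed.

(** Removable singularity at 0. On the circle [f z / (z - w) = f + w f / (z - w)] with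
    [z = circ r t]; the mean of [f] is [f 0 = 0], so Cauchy's formula reads [f w = w psi w] with
    [psi] a Cauchy integral, which is differentiable at 0 too. *)
Lemma holo_on_quotient (f : C -> C) (l : C) (R0 : R) :
  0 < R0 -> holo_on R0 f -> f 0 = 0 -> Cderiv f 0 l ->
  exists phi, holo_on R0 phi /\ phi 0 = l /\ forall z, f z = (z * phi z)%C.
Proof.
  intros HR Hf Hf0 Hl.
  (* Defining [phi] by the quotient itself makes the factorisation hold on all of C; the integral
     [psi] depends on a radius and serves only to prove differentiability. *)
  set (phi := fun z : C => if excluded_middle_informative (z = RtoC 0) then l else (f z / z)%C).
  assert (Hfac : forall z, f z = (z * phi z)%C).
  { intros z. unfold phi. destruct (excluded_middle_informative (z = RtoC 0)) as [->|n].
    - rewrite Hf0. ring.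
    - field. auto. }
  assert (Hphi0 : phi 0 = l).
  { unfold phi. destruct (excluded_middle_informative (RtoC 0 = RtoC 0)); tauto. }
  exists phi. split; [|auto].
  intros z Hz. pose proof (Cmod_ge_0 z). pose proof PI_RGT_0 as HPI.
  set (r := (Cmod z + R0) / 2).
  assert (Hr : Cmod z < r < R0) by (unfold r; lra).
  assert (H0r : Cmod 0 < r) by (rewrite Cmod_0; lra).
  set (psi := fun w => (/ (2 * PI) * CInt (fun t => f (circ r t) / (circ r t - w)) 0 (2 * PI)%R)%C).
  assert (Cf : Rcont_on (fun t => f (circ r t)) 0 (2 * PI)).
  { apply (Rcont_on_circ f r R0); auto. lra. }
  assert (Dpsi : forall w, Cmod w < r -> exists d, Cderiv psi w d).
  { intros w Hw. eexists. apply (Cderiv_mult (fun _ => / (2 * PI))%C). apply Cderiv_const.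
    apply (Cderiv_cauchy_kernel (fun t => f (circ r t))); auto. }
  assert (Hpsi : forall w, Cmod w < r -> f w = (w * psi w)%C).
  { intros w Hw.
    pose proof (cauchy_formula f w r R0 Hw (proj2 Hr) Hf) as E1.
    pose proof (mean_value_property f r R0 ltac:(lra) (proj2 Hr) Hf) as E2.
    rewrite Hf0 in E2.
    rewrite (CInt_ext _ (fun t => f (circ r t) + w * (f (circ r t) / (circ r t - w)))%C) in E1; [|lra|].
    - assert (Cq : Rcont_on (fun t => f (circ r t) / (circ r t - w))%C 0 (2 * PI)).
      { intros t Ht. apply Rcont_mult. apply Cf; auto. now apply Rcont_inv_circ_minus. }
      rewrite CInt_plus, CInt_scal, E2 in E1; auto; try lra.
      + unfold psi. pose proof RtoC_2PI_neq_0 as N.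
        replace (f w) with (/ (2 * PI) * (2 * PI * f w))%C.
        * rewrite <- E1. ring.
        * field. intros E. apply N. rewrite E. ring.
      + intros t Ht. apply Rcont_mult. apply Rcont_const. apply Cq; auto.
    - intros t _. field. now apply circ_minus_neq. }
  assert (Hpsi0 : psi 0 = l).
  { apply (Cderiv_unique f 0); auto.
    destruct (Dpsi 0 H0r) as [d Hd].
    apply (Cderiv_ext_loc (fun w => w * psi w)%C _ _ _ r).
    - lra.
    - intros w Hw. replace (w - 0)%C with w in Hw by ring. rewrite <- Hpsi; auto.
    - eapply Cderiv_eq. apply (Cderiv_mult (fun w => w)). apply Cderiv_id. exact Hd. ring. }
  destruct (Dpsi z (proj1 Hr)) as [d Hd]. exists d.
  apply (Cderiv_ext_loc psi _ _ _ (r - Cmod z)); auto. lra.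
  intros w Hw. unfold phi. destruct (excluded_middle_informative (w = RtoC 0)) as [->|n]; auto.
  rewrite Hpsi. field; auto.
  pose proof (Cmod_reverse_triangle w z). lra.
Qed.

(* Cauchy's formula for [f^n] gives the bound up to a factor independent of [n]. *)
Lemma maximum_principle (f : C -> C) (a : C) (r R0 M : R) :
  Cmod a < r -> r < R0 -> holo_on R0 f -> (forall t, Cmod (f (circ r t)) <= M) -> Cmod (f a) <= M.
Proof.
  intros Ha Hr Hf HM. pose proof (Cmod_ge_0 a). pose proof PI_RGT_0 as HPI.
  assert (HM0 : 0 <= M). { eapply Rle_trans. apply Cmod_ge_0. apply (HM 0). }
  (* The maximum of [|z| / |z - a|] allowed by the reverse triangle inequality on the circle. As
     [|f a|^n <= A M^n] for every [n], [M < |f a|] would make [(M / |f a|)^n] drop below [1 / A]. *)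
  set (A := r / (r - Cmod a)).
  assert (HA : 0 < A) by (apply Rdiv_lt_0_compat; lra).
  assert (Hn : forall n, Cmod (f a) ^ n <= A * M ^ n).
  { intros n.
    assert (Hfn : holo_on R0 (fun z => f z ^ n)%C).
    { intros z Hz. destruct (Hf z Hz) as [l Hl]. now apply Cderiv_pow with l. }
    pose proof (cauchy_formula _ a r R0 Ha Hr Hfn) as E.
    assert (B : Cmod (2 * PI * f a ^ n) <= (M ^ n * A) * (2 * PI - 0)).
    { rewrite <- E. apply CInt_bound. lra.
      - intros t Ht. apply Rcont_mult. apply Rcont_mult; [|apply Rcont_circ].
        + apply (Rcont_on_circ (fun z => f z ^ n)%C r R0 0 (2 * PI)); auto. lra.
        + now apply Rcont_inv_circ_minus.
      - intros t Ht. unfold Cdiv. rewrite !Cmod_mult, Cmod_inv, Cmod_pow, Cmod_circ by (try lra; now apply circ_minus_neq).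
        rewrite Rmult_assoc. apply Rmult_le_compat.
        + apply pow_le, Cmod_ge_0.
        + apply Rmult_le_pos. lra. apply Rlt_le, Rinv_0_lt_compat. apply Cmod_gt_0. now apply circ_minus_neq.
        + apply pow_incr. split. apply Cmod_ge_0. apply HM.
        + unfold A, Rdiv. apply Rmult_le_compat_l. lra. apply Rinv_le_contravar. lra.
          pose proof (Cmod_reverse_triangle (circ r t) a) as H1. rewrite Cmod_circ in H1; lra. }
    rewrite !Cmod_mult, Cmod_pow, !Cmod_R, !Rabs_pos_eq in B by lra.
    apply (Rmult_le_reg_l (2 * PI)). lra. lra. }
  apply Rnot_lt_le. intros Hlt.
  assert (Hq : Rabs (M / Cmod (f a)) < 1).
  { rewrite Rabs_pos_eq. apply (Rmult_lt_reg_r (Cmod (f a))). lra.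
    unfold Rdiv. rewrite Rmult_assoc, Rinv_l; lra.
    apply Rmult_le_pos; auto. apply Rlt_le, Rinv_0_lt_compat. lra. }
  destruct (pow_lt_1_zero _ Hq (/ A)) as [N HN]. { now apply Rinv_0_lt_compat. }
  specialize (HN N (le_n _)). specialize (Hn N).
  rewrite Rabs_pos_eq in HN.
  - unfold Rdiv in HN. rewrite Rpow_mult_distr, pow_inv in HN.
    assert (Hp : 0 < Cmod (f a) ^ N) by (apply pow_lt; lra).
    apply (Rmult_lt_compat_r (Cmod (f a) ^ N)) in HN; auto.
    rewrite Rmult_assoc, Rinv_l, Rmult_1_r in HN by lra.
    apply (Rmult_lt_compat_l A) in HN; auto.
    rewrite <- Rmult_assoc, Rinv_r, Rmult_1_l in HN by lra. lra.
  - apply pow_le. apply Rmult_le_pos; auto. apply Rlt_le, Rinv_0_lt_compat. lra.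
Qed.

(** Divide out the zero at 0 and apply the maximum principle to the quotient on circles of radius
    [r < 1]: its modulus is at most [1 / r], and [r] tends to 1. *)
Lemma schwarz (f : C -> C) :
  holo_on 1 f -> f 0 = 0 -> (forall z, Cmod z < 1 -> Cmod (f z) <= 1) ->
  forall z, Cmod z < 1 -> Cmod (f z) <= Cmod z.
Proof.
  intros Hf Hf0 Hb z Hz.
  destruct (Hf 0) as [l Hl]. rewrite Cmod_0; lra.
  destruct (holo_on_quotient f l 1 Rlt_0_1 Hf Hf0 Hl) as [phi [Hphi [_ Hfac]]].
  pose proof (Cmod_ge_0 z) as Hz0.
  assert (Hr : forall r, Cmod z < r < 1 -> Cmod (phi z) * r <= 1).
  { intros r Hr. assert (H : Cmod (phi z) <= / r).
    { apply (maximum_principle phi z r 1); try tauto.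
      intros t. apply (Rmult_le_reg_l r). lra. rewrite Rinv_r by lra.
      rewrite <- (Cmod_circ r t) at 1 by lra. rewrite <- Cmod_mult, <- Hfac.
      apply Hb. rewrite Cmod_circ; lra. }
    apply (Rmult_le_compat_r r) in H; [|lra]. rewrite Rinv_l in H; lra. }
  rewrite Hfac, Cmod_mult. rewrite <- (Rmult_1_r (Cmod z)) at 2.
  apply Rmult_le_compat_l; auto.
  apply Rnot_lt_le. intros Hlt. set (p := Cmod (phi z)) in *.
  (* If [p > 1] then [m < 1], and the radius [(m + 1) / 2] exceeds both [|z|] and [1 / p],
     contradicting [p r <= 1]. *)
  set (m := Rmax (Cmod z) (/ p)).
  assert (Hip : / p < 1). { rewrite <- Rinv_1. apply Rinv_lt_contravar; lra. }
  assert (Hm : m < 1) by (apply Rmax_lub_lt; auto).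
  assert (Hm1 : Cmod z <= m) by apply Rmax_l.
  assert (Hm2 : / p <= m) by apply Rmax_r.
  specialize (Hr ((m + 1) / 2) ltac:(lra)).
  assert (p * / p = 1) by (apply Rinv_r; lra). nra.
Qed.

(** * Injective holomorphic functions *)

Definition Rfun_cont (F : C -> R) (z : C) : Prop :=
  forall eps : R, 0 < eps -> exists delta : R, 0 < delta /\
    forall w : C, Cmod (w - z) < delta -> Rabs (F w - F z) < eps.

Lemma closed_disc_positive_bound (F : C -> R) (z0 : C) (rho : R) :
  (forall z, Cmod (z - z0) <= rho -> 0 < F z /\ Rfun_cont F z) ->
  exists d, 0 < d /\ forall z, Cmod (z - z0) <= rho -> d <= F z.
Proof.
  intros HF.
  (* One number serves both as the half-width of a square and as a lower bound for [F] on its part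
     in the disc. A square centred outside the disc is taken so small that it misses the disc. *)
  assert (Hloc : forall u v : R, exists delta : posreal, forall x y : R,
     Rabs (x - u) < delta -> Rabs (y - v) < delta -> Cmod ((x, y) - z0) <= rho -> delta <= F (x, y)).
  { intros u v.
    assert (Hnear : forall x y : R, Cmod ((x, y) - (u, v)) <= Rabs (x - u) + Rabs (y - v)).
    { intros x y. apply (Cmod_le_Re_Im ((x, y) - (u, v))). }
    destruct (Rle_lt_dec (Cmod ((u, v) - z0)) rho) as [Hin|Hout].
    - destruct (HF _ Hin) as [Hpos Hc].
      destruct (Hc (F (u, v) / 2)) as [d [Hd Hd2]]. lra.
      assert (Hm : 0 < Rmin (d / 2) (F (u, v) / 2)) by (apply Rmin_pos; lra).
      exists (mkposreal _ Hm). simpl. intros x y Hx Hy _.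
      assert (Hx' := Rlt_le_trans _ _ _ Hx (Rmin_l _ _)).
      assert (Hy' := Rlt_le_trans _ _ _ Hy (Rmin_l _ _)).
      specialize (Hnear x y). specialize (Hd2 (x, y) ltac:(lra)).
      apply Rabs_def2 in Hd2. pose proof (Rmin_r (d / 2) (F (u, v) / 2)). lra.
    - assert (Hm : 0 < (Cmod ((u, v) - z0) - rho) / 2) by lra.
      exists (mkposreal _ Hm). simpl. intros x y Hx Hy Hxy. exfalso.
      specialize (Hnear x y).
      pose proof (Cmod_minus_triangle (u, v) (x, y) z0) as T.
      rewrite (Cmod_minus_sym (u, v) (x, y)) in T. lra. }
  set (delta := fun u v => proj1_sig (constructive_indefinite_description _ (Hloc u v))).
  assert (Hdelta : forall u v x y : R, Rabs (x - u) < delta u v -> Rabs (y - v) < delta u v ->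
     Cmod ((x, y) - z0) <= rho -> delta u v <= F (x, y)).
  { intros u v. exact (proj2_sig (constructive_indefinite_description _ (Hloc u v))). }
  destruct z0 as [x0 y0].
  destruct (compactness_value_2d (x0 - rho) (x0 + rho) (y0 - rho) (y0 + rho) delta) as [d Hd].
  exists d. split. apply cond_pos.
  intros [x y] Hxy. destruct (Re_Im_le_Cmod ((x, y) - (x0, y0))) as [B1 B2].
  simpl in B1, B2.
  assert (B1' : Rabs (x + - x0) <= rho) by lra. assert (B2' : Rabs (y + - y0) <= rho) by lra.
  apply Rabs_le_between in B1'. apply Rabs_le_between in B2'.
  (* Compactness gives the covering square only under a double negation, which is harmless once the
     goal is [False]. *)
  apply Rnot_lt_le. intros Hlt.
  apply (Hd x y); [lra|lra|]. intros [u [v [_ [_ [Hu [Hv Hduv]]]]]].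
  specialize (Hdelta u v x y Hu Hv Hxy). lra.
Qed.

Lemma Rfun_cont_minus_const (F : C -> R) (c : R) (z : C) :
  Rfun_cont F z -> Rfun_cont (fun w => F w - c) z.
Proof.
  intros H eps He. destruct (H eps He) as [d [Hd H2]]. exists d. split; auto.
  intros w Hw. replace (F w - c - (F z - c)) with (F w - F z) by ring. auto.
Qed.

Lemma Rfun_cont_plus (F G : C -> R) (z : C) :
  Rfun_cont F z -> Rfun_cont G z -> Rfun_cont (fun w => F w + G w) z.
Proof.
  intros HF HG eps He.
  destruct (HF (eps / 2)) as [d1 [Hd1 H1]]. lra.
  destruct (HG (eps / 2)) as [d2 [Hd2 H2]]. lra.
  exists (Rmin d1 d2). split. now apply Rmin_pos.
  intros w Hw.
  specialize (H1 w (Rlt_le_trans _ _ _ Hw (Rmin_l _ _))).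
  specialize (H2 w (Rlt_le_trans _ _ _ Hw (Rmin_r _ _))).
  apply Rabs_def2 in H1. apply Rabs_def2 in H2. apply Rabs_def1; lra.
Qed.

Lemma Rabs_Cmod_minus (x y : C) : Rabs (Cmod x - Cmod y) <= Cmod (x - y).
Proof.
  pose proof (Cmod_reverse_triangle x y). pose proof (Cmod_reverse_triangle y x) as H1.
  rewrite Cmod_minus_sym in H1. apply Rabs_le. lra.
Qed.

Lemma Rfun_cont_Cmod_minus (f : C -> C) (w z : C) :
  Ccont f z -> Rfun_cont (fun x => Cmod (f x - w)) z.
Proof.
  intros H eps He. destruct (H eps He) as [d [Hd H2]]. exists d. split; auto.
  intros x Hx. eapply Rle_lt_trans; [|apply (H2 x Hx)].
  eapply Rle_trans. apply Rabs_Cmod_minus. right. f_equal. ring.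
Qed.

(** If the infimum [- s] were not attained, [F - (- s)] would be positive on the disc, hence bounded
    below by some [d > 0], and [- s] would not be the infimum. *)
Lemma closed_disc_min (F : C -> R) (z0 : C) (rho : R) :
  0 <= rho -> (forall z, Cmod (z - z0) <= rho -> 0 <= F z /\ Rfun_cont F z) ->
  exists z1, Cmod (z1 - z0) <= rho /\ forall z, Cmod (z - z0) <= rho -> F z1 <= F z.
Proof.
  intros Hrho HF.
  assert (H0 : Cmod (z0 - z0) <= rho). { replace (z0 - z0)%C with (RtoC 0) by ring. now rewrite Cmod_0. }
  destruct (completeness (fun x => exists z, Cmod (z - z0) <= rho /\ x = - F z)) as [s [S1 S2]].
  - exists 0. intros x [z [Hz ->]]. destruct (HF z Hz). lra.
  - exists (- F z0), z0. auto.
  - apply NNPP. intros Hno.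
    destruct (closed_disc_positive_bound (fun z => F z - - s) z0 rho) as [d [Hd Hb]].
    + intros z Hz. split; [|apply Rfun_cont_minus_const, HF; auto].
      assert (- F z <= s) by (apply S1; exists z; auto).
      destruct (Req_dec (- F z) s) as [E|N]; [|lra].
      exfalso. apply Hno. exists z. split; auto. intros w Hw.
      assert (- F w <= s) by (apply S1; exists w; auto). lra.
    + assert (s <= s - d); [|lra].
      apply S2. intros x [z [Hz ->]]. specialize (Hb z Hz). lra.
Qed.

(* A minimum of [|h - w|] inside the disc must be a zero, since a nonzero derivative
   allows a step which decreases [|h - w|]. *)
Lemma local_surjectivity (h dh : C -> C) (z0 : C) (rho : R) :
  0 < rho ->
  (forall z, Cmod (z - z0) <= rho -> Cderiv h z (dh z) /\ dh z <> 0) ->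
  (forall z, Cmod (z - z0) = rho -> h z <> h z0) ->
  exists d, 0 < d /\ forall w, Cmod (w - h z0) < d ->
    exists z, Cmod (z - z0) < rho /\ h z = w.
Proof.
  intros Hrho Hd Hbd.
  assert (Hc : forall z, Cmod (z - z0) <= rho -> Ccont h z).
  { intros z Hz. eapply Cderiv_cont. apply Hd; auto. }
  (* The extra term vanishes on the boundary circle and is positive inside, so compactness of the
     disc yields [|h - h z0| >= d] on the circle. Targets within [d / 2] of [h z0] then force the
     minimum of [|h - w|] into the interior. *)
  destruct (closed_disc_positive_bound (fun z => Cmod (h z - h z0) + (rho - Cmod (z - z0))) z0 rho)
    as [d [Hd0 Hdb]].
  { intros z Hz. split.
    - pose proof (Cmod_ge_0 (h z - h z0)).
      destruct (Rle_lt_or_eq_dec _ _ Hz) as [Hlt|E]; [lra|].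
      assert (0 < Cmod (h z - h z0)); [|lra].
      apply Cmod_gt_0. intros E2. apply (Hbd z E).
      replace (h z) with (h z - h z0 + h z0)%C by ring. rewrite E2. ring.
    - apply Rfun_cont_plus. apply Rfun_cont_Cmod_minus; auto.
      intros eps He. exists eps. split; auto. intros w Hw.
      replace (rho - Cmod (w - z0) - (rho - Cmod (z - z0))) with (Cmod (z - z0) - Cmod (w - z0)) by ring.
      eapply Rle_lt_trans. apply Rabs_Cmod_minus.
      replace (z - z0 - (w - z0))%C with (z - w)%C by ring. now rewrite Cmod_minus_sym. }
  exists (d / 2). split. lra.
  intros w Hw.
  destruct (closed_disc_min (fun z => Cmod (h z - w)) z0 rho) as [z1 [Hz1 Hmin]].
  { lra. }
  { intros z Hz. split. apply Cmod_ge_0. apply Rfun_cont_Cmod_minus; auto. }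
  assert (Hz0 : Cmod (z0 - z0) <= rho). { replace (z0 - z0)%C with (RtoC 0) by ring. rewrite Cmod_0; lra. }
  assert (Hlt : Cmod (z1 - z0) < rho).
  { destruct (Rle_lt_or_eq_dec _ _ Hz1) as [Hlt|E]; auto. exfalso.
    specialize (Hdb z1 Hz1). rewrite E in Hdb. specialize (Hmin z0 Hz0).
    rewrite (Cmod_minus_sym (h z0) w) in Hmin.
    pose proof (Cmod_minus_triangle (h z1) w (h z0)). lra. }
  exists z1. split; auto. apply NNPP. intros Hne.
  set (c := (h z1 - w)%C).
  assert (Hcpos : 0 < Cmod c).
  { apply Cmod_gt_0. intros E. apply Hne. replace (h z1) with (c + w)%C by (unfold c; ring). rewrite E. ring. }
  destruct (Hd z1 Hz1) as [D Dn]. set (l := dh z1) in *.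
  assert (Hl : 0 < Cmod l) by now apply Cmod_gt_0.
  destruct (D (Cmod l / 2)) as [e [He1 He2]]. lra.
  set (m := Rmin e (rho - Cmod (z1 - z0))).
  assert (Hm : 0 < m) by (apply Rmin_pos; lra).
  set (q := Cmod c / Cmod l). assert (Hq : 0 < q) by (apply Rdiv_lt_0_compat; auto).
  set (tau := Rmin 1 (m / (2 * q))).
  assert (Htau : 0 < tau) by (apply Rmin_pos; [lra|apply Rdiv_lt_0_compat; lra]).
  assert (Htau1 : tau <= 1) by apply Rmin_l.
  assert (Htau2 : tau * q <= m / 2).
  { replace (m / 2) with (m / (2 * q) * q) by (field; lra). apply Rmult_le_compat_r. lra. apply Rmin_r. }
  (* A Newton step towards [w], shortened by [tau] to stay in the disc and within reach of the
     linear approximation. The linear part leaves [(1 - tau) |c|] and the error costs at most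
     [tau |c| / 2], so [|h z - w| < |c|]. *)
  set (z := (z1 - RtoC tau * (c / l))%C).
  assert (Hzz : Cmod (z - z1) = tau * q).
  { replace (z - z1)%C with (- (RtoC tau * (c / l)))%C by (unfold z; ring).
    rewrite Cmod_opp, Cmod_mult, Cmod_div, Cmod_R, Rabs_pos_eq by (auto; lra). reflexivity. }
  pose proof (Rmin_l e (rho - Cmod (z1 - z0))) as M1. pose proof (Rmin_r e (rho - Cmod (z1 - z0))) as M2.
  fold m in M1, M2.
  specialize (He2 z ltac:(lra)). rewrite Hzz in He2.
  assert (Hzin : Cmod (z - z0) <= rho).
  { pose proof (Cmod_minus_triangle z z1 z0). lra. }
  specialize (Hmin z Hzin).
  assert (E1 : (h z - w = (h z - h z1 - l * (z - z1)) + RtoC (1 - tau) * c)%C).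
  { unfold z. rewrite RtoC_minus. unfold c. field. auto. }
  assert (Cmod (h z - w) <= Cmod l / 2 * (tau * q) + (1 - tau) * Cmod c).
  { rewrite E1. eapply Rle_trans. apply Cmod_triangle.
    rewrite (Cmod_mult (RtoC (1 - tau))), Cmod_R, (Rabs_pos_eq (1 - tau)) by lra. lra. }
  assert (E2 : Cmod l / 2 * (tau * q) = tau * Cmod c / 2) by (unfold q; field; lra).
  fold c in Hmin. nra.
Qed.

(** [k] is chosen pointwise and is arbitrary off the image of [h]. Local surjectivity shows that all
    points near [h z0] come from points near [z0], so the arbitrary values do not affect the
    derivative. *)
Lemma holomorphic_inverse (h dh : C -> C) :
  (forall z, Cmod z < 1 -> Cderiv h z (dh z) /\ dh z <> 0) ->
  (forall z w, Cmod z < 1 -> Cmod w < 1 -> h z = h w -> z = w) ->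
  exists k : C -> C, (forall z, Cmod z < 1 -> k (h z) = z) /\
    forall z, Cmod z < 1 -> Cderiv k (h z) (/ dh z).
Proof.
  intros Hd Hinj.
  assert (Hch : forall y, exists w, forall z, Cmod z < 1 -> h z = y -> w = z).
  { intros y. destruct (classic (exists z, Cmod z < 1 /\ h z = y)) as [[z [Hz E]]|N].
    - exists z. intros z' Hz' E'. apply Hinj; auto. congruence.
    - exists 0. intros z Hz E. exfalso. apply N. now exists z. }
  set (k := fun y => proj1_sig (constructive_indefinite_description _ (Hch y))).
  assert (Hk : forall z, Cmod z < 1 -> k (h z) = z).
  { intros z Hz. apply (proj2_sig (constructive_indefinite_description _ (Hch (h z)))); auto. }
  exists k. split; auto.
  intros z0 Hz0. destruct (Hd z0 Hz0) as [D Dn]. set (l := dh z0) in *.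
  assert (Hl : 0 < Cmod l) by now apply Cmod_gt_0.
  intros eps He.
  (* The first bound gives [|l| |z - z0| <= 2 |h z - h z0|]. With it, the second turns the error
     [e1 |z - z0|] into at most [eps |l| |h z - h z0|], and dividing by [l] leaves the required
     bound. *)
  set (e1 := Rmin (Cmod l / 2) (eps * (Cmod l * Cmod l) / 2)).
  assert (He1 : 0 < e1).
  { apply Rmin_pos. lra. apply Rdiv_lt_0_compat; [|lra]. apply Rmult_lt_0_compat; auto.
    apply Rmult_lt_0_compat; auto. }
  assert (E1 : e1 <= Cmod l / 2) by apply Rmin_l.
  assert (E2 : e1 <= eps * (Cmod l * Cmod l) / 2) by apply Rmin_r.
  destruct (D e1 He1) as [d1 [Hd1 H1]].
  set (rho := Rmin d1 (1 - Cmod z0) / 2).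
  assert (Hm : 0 < Rmin d1 (1 - Cmod z0)) by (apply Rmin_pos; lra).
  pose proof (Rmin_l d1 (1 - Cmod z0)) as M1. pose proof (Rmin_r d1 (1 - Cmod z0)) as M2.
  assert (Hdisc : forall z, Cmod (z - z0) <= rho -> Cmod z < 1).
  { intros z Hz. pose proof (Cmod_reverse_triangle z z0). unfold rho in Hz. lra. }
  destruct (local_surjectivity h dh z0 rho) as [d [Hd2 Hsurj]].
  - unfold rho; lra.
  - intros z Hz. apply Hd. auto.
  - intros z Hz E. assert (z = z0). { apply Hinj; auto. apply Hdisc; lra. }
    subst z. replace (z0 - z0)%C with (RtoC 0) in Hz by ring. rewrite Cmod_0 in Hz. unfold rho in Hz. lra.
  - exists d. split; auto. intros y Hy.
    destruct (Hsurj y Hy) as [z [Hz Ey]]. subst y.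
    rewrite !Hk by (auto; apply Hdisc; lra).
    specialize (H1 z ltac:(unfold rho in Hz; lra)).
    set (X := (h z - h z0)%C) in *. set (D0 := (z - z0)%C) in *.
    pose proof (Cmod_ge_0 D0) as P0. pose proof (Cmod_ge_0 X) as P1.
    assert (B : Cmod l * Cmod D0 <= 2 * Cmod X).
    { pose proof (Cmod_reverse_triangle (l * D0) X) as T.
      rewrite Cmod_minus_sym in T. rewrite Cmod_mult in T. nra. }
    replace (D0 - / l * X)%C with (/ l * - (X - l * D0))%C by (field; auto).
    rewrite Cmod_mult, Cmod_opp, Cmod_inv by auto.
    apply (Rmult_le_reg_l (Cmod l)); auto.
    rewrite <- Rmult_assoc, Rinv_r, Rmult_1_l by lra.
    assert (e1 * Cmod D0 <= eps * (Cmod l * Cmod l) / 2 * Cmod D0) by (apply Rmult_le_compat_r; auto).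
    assert (eps * Cmod l / 2 * (Cmod l * Cmod D0) <= eps * Cmod l / 2 * (2 * Cmod X)).
    { apply Rmult_le_compat_l; auto. apply Rlt_le, Rdiv_lt_0_compat; [|lra]. now apply Rmult_lt_0_compat. }
    lra.
Qed.

(** * Starlike functions *)

Lemma Re_le_Cmod (z : C) : Re z <= Cmod z.
Proof. eapply Rle_trans; [apply Rle_abs|apply Re_Im_le_Cmod]. Qed.

(* With [k] the inverse of [h], the map [z |-> k (t h(z))] sends the disc into itself and
   fixes 0; differentiating [|k (t h(z))| <= |z|] at [t = 1] gives the claim. *)
Lemma starlike_Re_nonneg (h dh : C -> C) (z : C) :
  (forall w, Cmod w < 1 -> Cderiv h w (dh w) /\ dh w <> 0) ->
  starlike_analytic h -> Cmod z < 1 -> 0 <= Re (Cconj z * (h z / dh z)).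
Proof.
  intros Hd [_ [Hinj [Hh0 Hstar]]] Hz.
  destruct (holomorphic_inverse h dh Hd) as [k [Hk Dk]]; [exact Hinj|].
  assert (Hz0 : Cmod 0 < 1) by (rewrite Cmod_0; lra).
  assert (Hsub : forall t, 0 <= t <= 1 -> Cmod (k (RtoC t * h z)%C) <= Cmod z).
  { intros t Ht. apply (schwarz (fun z => k (RtoC t * h z)%C)); auto.
    (* Starlikeness places [t h(x)] in the image of [h], where [k] is known to be differentiable. *)
    - intros x Hx. destruct (Hstar x t Hx Ht) as [w [Hw Ew]].
      eexists. apply (Cderiv_comp k (fun x => RtoC t * h x)%C).
      + rewrite <- Ew. apply Dk. exact Hw.
      + apply (Cderiv_mult (fun _ => RtoC t) h). apply Cderiv_const. now apply Hd.
    - rewrite Hh0. replace (RtoC t * 0)%C with (h 0) by (rewrite Hh0; ring). now apply Hk.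
    - intros x Hx. destruct (Hstar x t Hx Ht) as [w [Hw Ew]].
      rewrite <- Ew, Hk by exact Hw. now apply Rlt_le. }
  set (q := (h z / dh z)%C).
  (* At [t = 1 - tau], [k (t h(z)) = z - tau q + e] with [|e| <= eps tau |h z|]. Multiplying by
     [Cconj z] and using that the modulus is at most [|z|] cancels [|z|^2] and leaves
     [tau Re (Cconj z * q) >= - |z| |e|]. *)
  assert (HA : forall eps, 0 < eps -> - (eps * Cmod (h z)) <= Re (Cconj z * q)).
  { intros eps He. destruct (Dk z Hz eps He) as [d [Hd0 Hd1]].
    pose proof (Cmod_ge_0 (h z)) as Hhz.
    set (tau := Rmin 1 (d / (2 * (1 + Cmod (h z))))).
    assert (Ht0 : 0 < tau) by (apply Rmin_pos; [lra|apply Rdiv_lt_0_compat; lra]).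
    assert (Ht1 : tau <= 1) by apply Rmin_l.
    assert (Ht2 : tau * (1 + Cmod (h z)) <= d / 2).
    { replace (d / 2) with (d / (2 * (1 + Cmod (h z))) * (1 + Cmod (h z))) by (field; lra).
      apply Rmult_le_compat_r. lra. apply Rmin_r. }
    assert (E : (RtoC (1 - tau) * h z - h z = - (RtoC tau * h z))%C) by (rewrite RtoC_minus; ring).
    specialize (Hd1 (RtoC (1 - tau) * h z)%C). rewrite E, Hk, Cmod_opp, Cmod_mult, Cmod_R, Rabs_pos_eq in Hd1 by (auto; lra).
    specialize (Hd1 ltac:(nra)).
    specialize (Hsub (1 - tau) ltac:(lra)).
    set (w := k (RtoC (1 - tau) * h z)%C) in *.
    set (e := (w - z - / dh z * - (RtoC tau * h z))%C) in *.
    assert (Ew : w = (z - RtoC tau * q + e)%C) by (unfold e, q, Cdiv; ring).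
    assert (R1 : Re (Cconj z * w) = Cmod z ^ 2 - tau * Re (Cconj z * q) + Re (Cconj z * e)).
    { rewrite Ew, Cmod2_alt. unfold Re, Im, Cconj, Cmult, Cplus, Cminus, Copp, RtoC; simpl. ring. }
    pose proof (Re_le_Cmod (Cconj z * w)) as R2. rewrite Cmod_mult, Cmod_conj in R2.
    pose proof (Re_Im_le_Cmod (Cconj z * e)) as [R3 _]. rewrite Cmod_mult, Cmod_conj in R3.
    apply Rabs_le_between in R3.
    pose proof (Cmod_ge_0 z). pose proof (Cmod_ge_0 e).
    assert (Cmod z * Cmod w <= Cmod z ^ 2) by nra.
    assert (Cmod z * Cmod e <= 1 * Cmod e) by (apply Rmult_le_compat_r; lra).
    apply (Rmult_le_reg_l tau); lra. }
  fold q. apply Rnot_lt_le. intros Hneg.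
  pose proof (Cmod_ge_0 (h z)) as Hhz.
  set (x := Re (Cconj z * q)) in *.
  specialize (HA (- x / (2 * (1 + Cmod (h z))))).
  assert (Hp : 0 < - x / (2 * (1 + Cmod (h z)))) by (apply Rdiv_lt_0_compat; lra).
  specialize (HA Hp).
  assert (Hq : - x / (2 * (1 + Cmod (h z))) * (2 * (1 + Cmod (h z))) = - x) by (field; lra).
  nra.
Qed.

(** A nonnegative real part of [H * Cconj (dh)] is equivalent to [|dh - H| <= |dh + H|], the Cayley
    transform of a half-plane. It also gives [|dh + H|^2 >= |dh|^2 > 0], so the quotient is
    holomorphic; it vanishes at 0 because [dh 0 = H 0 = 1]. *)
Lemma starlike_schwarz (h dh H : C -> C) (z : C) :
  (forall w, Cmod w < 1 -> Cderiv h w (dh w) /\ dh w <> 0) ->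
  starlike_analytic h -> dh 0 = 1 -> holo_on 1 H -> H 0 = 1 ->
  (forall w, h w = (w * H w)%C) -> Cmod z < 1 ->
  Cmod (dh z - H z) <= Cmod z * Cmod (dh z + H z).
Proof.
  intros Hd Hs Hdh0 HH HH0 Hfac Hz.
  assert (Hre : forall w, Cmod w < 1 -> 0 <= Re (H w * Cconj (dh w))).
  { intros w Hw. destruct (classic (w = 0)) as [->|n].
    - rewrite HH0, Hdh0. simpl. lra.
    - pose proof (starlike_Re_nonneg h dh w Hd Hs Hw) as R0. rewrite Hfac in R0.
      assert (Hdw := proj2 (Hd w Hw)).
      assert (Hw2 : 0 < Cmod w ^ 2) by (apply pow_lt; now apply Cmod_gt_0).
      assert (Hd2 : 0 < Cmod (dh w) ^ 2) by (apply pow_lt; now apply Cmod_gt_0).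
      (* A positive real factor separates the quotient from the product form, so the sign of the
         real part carries over. *)
      assert (E : (Cconj w * (w * H w / dh w) = RtoC (Cmod w ^ 2 / Cmod (dh w) ^ 2) * (H w * Cconj (dh w)))%C).
      { rewrite RtoC_div, !RtoC_pow by lra. rewrite <- !RtoC_pow. rewrite !Cmod2_conj.
        field. split; auto. intros E. apply Hdw. rewrite <- (Cconj_conj (dh w)), E.
        unfold Cconj, RtoC; simpl. f_equal; ring. }
      rewrite E in R0.
      replace (Re (RtoC (Cmod w ^ 2 / Cmod (dh w) ^ 2) * (H w * Cconj (dh w))))
        with ((Cmod w ^ 2 / Cmod (dh w) ^ 2) * Re (H w * Cconj (dh w))) in R0.
      + apply (Rmult_le_reg_l (Cmod w ^ 2 / Cmod (dh w) ^ 2)); [|lra]. now apply Rdiv_lt_0_compat.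
      + unfold Re, Cmult, RtoC; simpl. ring. }
  assert (Hsq : forall w, Cmod w < 1 ->
     Cmod (dh w + H w) ^ 2 = Cmod (dh w) ^ 2 + Cmod (H w) ^ 2 + 2 * Re (H w * Cconj (dh w))).
  { intros w _. rewrite !Cmod2_alt. unfold Re, Im, Cconj, Cmult, Cplus; simpl. ring. }
  assert (Hsq' : forall w, Cmod w < 1 ->
     Cmod (dh w - H w) ^ 2 = Cmod (dh w) ^ 2 + Cmod (H w) ^ 2 - 2 * Re (H w * Cconj (dh w))).
  { intros w _. rewrite !Cmod2_alt. unfold Re, Im, Cconj, Cmult, Cminus, Cplus, Copp; simpl. ring. }
  assert (Hne : forall w, Cmod w < 1 -> 0 < Cmod (dh w + H w)).
  { intros w Hw. specialize (Hsq w Hw). specialize (Hre w Hw).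
    assert (0 < Cmod (dh w) ^ 2) by (apply pow_lt, Cmod_gt_0, Hd; auto).
    pose proof (pow2_ge_0 (Cmod (H w))). pose proof (Cmod_ge_0 (dh w + H w)).
    destruct (Rle_lt_or_eq_dec _ _ H2) as [|E]; auto. rewrite <- E in Hsq. lra. }
  assert (HQ : Cmod ((dh z - H z) / (dh z + H z)) <= Cmod z).
  { apply (schwarz (fun w => (dh w - H w) / (dh w + H w))%C); auto.
    - intros w Hw.
      destruct (holo_on_deriv h dh 1 (fun x Hx => proj1 (Hd x Hx)) w Hw) as [a Ha].
      destruct (HH w Hw) as [b Hb].
      eexists. apply (Cderiv_div (fun w => dh w - H w)%C (fun w => dh w + H w)%C).
      + apply Cderiv_minus; eauto.
      + apply Cderiv_plus; eauto.
      + apply Cmod_gt_0. auto.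
    - rewrite Hdh0, HH0. field.
    - intros w Hw. specialize (Hne w Hw). rewrite Cmod_div by (apply Cmod_gt_0; auto).
      apply (Rmult_le_reg_r (Cmod (dh w + H w))); auto.
      unfold Rdiv. rewrite Rmult_assoc, Rinv_l, Rmult_1_r, Rmult_1_l by lra.
      apply Rsqr_incr_0; try apply Cmod_ge_0. rewrite !Rsqr_pow2, Hsq, Hsq' by auto.
      specialize (Hre w Hw). lra. }
  specialize (Hne z Hz). rewrite Cmod_div in HQ by (apply Cmod_gt_0; auto).
  apply (Rmult_le_compat_r (Cmod (dh z + H z))) in HQ; [|lra].
  unfold Rdiv in HQ. rewrite Rmult_assoc, Rinv_l, Rmult_1_r in HQ by lra. exact HQ.
Qed.

(** * Growth and distortion of starlike functions *)

(** The quotient [d / H] lies in the Apollonius disc [|q - 1| <= rho |q + 1|], whose real parts run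
    from [(1 - rho) / (1 + rho)] to its inverse; everything is multiplied by [|H|^2] to avoid
    division. *)
Lemma Re_quotient_bounds (d H : C) (rho : R) :
  0 <= rho < 1 -> 0 < Cmod H -> Cmod (d - H) <= rho * Cmod (d + H) ->
  (1 - rho) * Cmod H ^ 2 <= (1 + rho) * Re (Cconj H * d) /\
  (1 - rho) * Re (Cconj H * d) <= (1 + rho) * Cmod H ^ 2.
Proof.
  intros Hr HH Hb.
  set (X := Re (Cconj H * d)). set (A := Cmod H ^ 2). set (B := Cmod d ^ 2).
  assert (HA : 0 < A) by (now apply pow_lt).
  assert (S1 : Cmod (d - H) ^ 2 = A + B - 2 * X).
  { unfold A, B, X. rewrite !Cmod2_alt. unfold Re, Im, Cconj, Cmult, Cminus, Cplus, Copp; simpl. ring. }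
  assert (S2 : Cmod (d + H) ^ 2 = A + B + 2 * X).
  { unfold A, B, X. rewrite !Cmod2_alt. unfold Re, Im, Cconj, Cmult, Cplus; simpl. ring. }
  assert (S3 : A + B - 2 * X <= rho ^ 2 * (A + B + 2 * X)).
  { rewrite <- S1, <- S2, <- Rpow_mult_distr. apply pow_incr. split; auto. apply Cmod_ge_0. }
  assert (S4 : X ^ 2 <= A * B).
  { unfold A, B. rewrite <- Rpow_mult_distr, <- (Cmod_conj H), <- Cmod_mult.
    rewrite <- (pow2_abs X). apply pow_incr. split. apply Rabs_pos. apply Re_Im_le_Cmod. }
  (* The claims are [P >= 0] and [Q <= 0]. Eliminating [B] by [X^2 <= A B] gives [P Q <= 0], and
     [(1 - rho) P - (1 + rho) Q >= 0] excludes the wrong distribution of signs. *)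
  set (P := (1 + rho) * X - (1 - rho) * A). set (Q := (1 - rho) * X - (1 + rho) * A).
  assert (PQ : P * Q <= 0).
  { assert (E : P * Q = (1 - rho ^ 2) * (X ^ 2 + A * A) - 2 * (1 + rho ^ 2) * A * X) by (unfold P, Q; ring).
    assert (A * ((A + B) * (1 - rho ^ 2)) <= A * (2 * X * (1 + rho ^ 2))) by (apply Rmult_le_compat_l; lra).
    assert (0 <= (1 - rho ^ 2)) by nra.
    assert ((1 - rho ^ 2) * X ^ 2 <= (1 - rho ^ 2) * (A * B)) by (apply Rmult_le_compat_l; lra).
    lra. }
  assert (D : (1 - rho) * P - (1 + rho) * Q = 4 * rho * A) by (unfold P, Q; ring).
  assert (0 <= rho * A) by (apply Rmult_le_pos; lra).
  split.
  - assert (0 <= P); [|unfold P in *; lra]. apply Rnot_lt_le. intros HP.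
    assert (0 <= Q) by nra. nra.
  - assert (Q <= 0); [|unfold Q in *; lra]. apply Rnot_lt_le. intros HQ.
    assert (P <= 0) by nra. nra.
Qed.

Lemma Rderiv_along_ray (f : C -> C) (z l : C) (t : R) :
  Cderiv f (RtoC t * z)%C l -> Rderiv (fun s => f (RtoC s * z)%C) t (l * z)%C.
Proof.
  intros Hf.
  assert (Hest : forall eps, 0 < eps -> exists d, 0 < d /\ forall y, Rabs y < d ->
     Cmod (f (RtoC (t + y) * z) - f (RtoC t * z) - RtoC y * (l * z))%C <= eps * Rabs y).
  { intros eps He. pose proof (Cmod_ge_0 z) as Hz.
    destruct (Hf (eps / (1 + Cmod z))) as [d [Hd H]]. apply Rdiv_lt_0_compat; lra.
    exists (d / (1 + Cmod z)). split. apply Rdiv_lt_0_compat; lra.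
    intros y Hy. specialize (H (RtoC (t + y) * z)%C).
    assert (E : (RtoC (t + y) * z - RtoC t * z = RtoC y * z)%C) by (rewrite RtoC_plus; ring).
    rewrite E, Cmod_mult, Cmod_R in H.
    pose proof (Rabs_pos y).
    assert (Hlt : Rabs y * Cmod z < d).
    { apply (Rmult_lt_compat_r (1 + Cmod z)) in Hy; [|lra].
      unfold Rdiv in Hy. rewrite Rmult_assoc, Rinv_l in Hy by lra. nra. }
    specialize (H Hlt).
    replace (RtoC y * (l * z))%C with (l * (RtoC y * z))%C by ring.
    eapply Rle_trans. exact H.
    replace (eps / (1 + Cmod z) * (Rabs y * Cmod z)) with ((eps * Rabs y) * (Cmod z / (1 + Cmod z))) by (field; lra).
    rewrite <- (Rmult_1_r (eps * Rabs y)) at 2. apply Rmult_le_compat_l. nra.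
    apply (Rmult_le_reg_r (1 + Cmod z)). lra. unfold Rdiv. rewrite Rmult_assoc, Rinv_l; lra. }
  split; apply is_derive_Reals; intros eps He;
  (destruct (Hest (eps / 2)) as [d [Hd H]]; [lra|]);
  exists (mkposreal d Hd); intros y Hy0 Hy; specialize (H y Hy);
  pose proof (Rabs_pos_lt y Hy0) as Py;
  pose proof (Re_Im_le_Cmod (f (RtoC (t + y) * z) - f (RtoC t * z) - RtoC y * (l * z))%C) as [B1 B2].
  - replace ((Re (f (RtoC (t + y) * z)%C) - Re (f (RtoC t * z)%C)) / y - Re (l * z))
      with (Re (f (RtoC (t + y) * z) - f (RtoC t * z) - RtoC y * (l * z))%C / y).
    + unfold Rdiv. rewrite Rabs_mult, Rabs_inv. apply (Rmult_lt_reg_r (Rabs y)); auto.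
      rewrite Rmult_assoc, Rinv_l by lra. nra.
    + unfold Re, Cmult, Cminus, Cplus, Copp, RtoC; simpl. field. auto.
  - replace ((Im (f (RtoC (t + y) * z)%C) - Im (f (RtoC t * z)%C)) / y - Im (l * z))
      with (Im (f (RtoC (t + y) * z) - f (RtoC t * z) - RtoC y * (l * z))%C / y).
    + unfold Rdiv. rewrite Rabs_mult, Rabs_inv. apply (Rmult_lt_reg_r (Rabs y)); auto.
      rewrite Rmult_assoc, Rinv_l by lra. nra.
    + unfold Im, Cmult, Cminus, Cplus, Copp, RtoC; simpl. field. auto.
Qed.

Lemma is_derive_Cmod_sqr (f : R -> C) (t : R) (l : C) :
  Rderiv f t l -> is_derive (fun s => Cmod (f s) ^ 2) t (2 * Re (Cconj (f t) * l)).
Proof.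
  intros [H1 H2].
  pose proof (is_derive_plus _ _ t _ _ (is_derive_mult _ _ t _ _ H1 H1 Rmult_comm)
    (is_derive_mult _ _ t _ _ H2 H2 Rmult_comm)) as D.
  eapply is_derive_ext; [|evar_last; [exact D|]].
  - intros s. simpl. pose proof (Cmod2_alt (f s)) as E.
    unfold plus, mult; simpl. simpl in E. rewrite E. ring.
  - unfold plus, mult, Re, Im, Cconj, Cmult; simpl. ring.
Qed.

(** As [w H'(w) = h'(w) - H(w)], the bounds on the real part give [N' <= 2 ((1 + tr) / (1 - tr) - 1)
    N / t = 4 r N / (1 - tr)], and likewise [N' >= - 4 r N / (1 + tr)]. These are the logarithmic
    derivatives of [(1 - tr)^(-4)] and [(1 + tr)^(-4)], whence the exponent 4 for the squared
    modulus. *)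
Lemma growth (h dh H dH : C -> C) (z : C) :
  (forall w, Cmod w < 1 -> Cderiv h w (dh w)) -> (forall w, Cmod w < 1 -> Cderiv H w (dH w)) ->
  H 0 = 1 -> (forall w, h w = (w * H w)%C) -> (forall w, Cmod w < 1 -> H w <> 0) ->
  (forall w, Cmod w < 1 -> Cmod (dh w - H w) <= Cmod w * Cmod (dh w + H w)) ->
  Cmod z < 1 ->
  Cmod (H z) * (1 - Cmod z) ^ 2 <= 1 /\ 1 <= Cmod (H z) * (1 + Cmod z) ^ 2.
Proof.
  intros Hh HH HH0 Hfac Hne Hb Hz. pose proof (Cmod_ge_0 z) as Hz0. set (r := Cmod z) in *.
  set (N := fun t => Cmod (H (RtoC t * z)%C) ^ 2).
  set (dN := fun t => 2 * Re (Cconj (H (RtoC t * z)%C) * (dH (RtoC t * z)%C * z))).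
  assert (Hin : forall t, 0 <= t <= 1 -> Cmod (RtoC t * z) = t * r).
  { intros t Ht. rewrite Cmod_mult, Cmod_R, Rabs_pos_eq by lra. reflexivity. }
  assert (Hin1 : forall t, 0 <= t <= 1 -> Cmod (RtoC t * z) < 1).
  { intros t Ht. rewrite Hin by auto. nra. }
  assert (HN : forall t, 0 <= t <= 1 -> is_derive N t (dN t)).
  { intros t Ht. apply (is_derive_Cmod_sqr (fun s => H (RtoC s * z)%C)).
    apply Rderiv_along_ray. apply HH. auto. }
  (* [t = 0] is excluded because a factor [t] is cancelled; the mean value theorem asks for interior
     points only. *)
  assert (HdN : forall t, 0 < t < 1 ->
     - (4 * r * N t) <= dN t * (1 + t * r) /\ dN t * (1 - t * r) <= 4 * r * N t).
  { intros t Ht. set (w := (RtoC t * z)%C).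
    assert (Hw : Cmod w < 1) by (apply Hin1; lra).
    assert (Hw2 : Cmod w = t * r) by (apply Hin; lra).
    assert (Edh : dh w = (H w + w * dH w)%C).
    { apply (Cderiv_unique h w); auto.
      apply (Cderiv_ext_loc (fun x => x * H x)%C _ _ _ 1). lra. intros; symmetry; apply Hfac.
      eapply Cderiv_eq. apply (Cderiv_mult (fun x => x)). apply Cderiv_id. apply HH; auto. ring. }
    destruct (Re_quotient_bounds (dh w) (H w) (t * r)) as [B1 B2].
    - split. apply Rmult_le_pos; lra. rewrite <- Hw2; auto.
    - apply Cmod_gt_0. auto.
    - rewrite <- Hw2. auto.
    - assert (E : t * dN t = 2 * (Re (Cconj (H w) * dh w) - N t)).
      { assert (E' : dh w = (H w + RtoC t * (dH w * z))%C) by (rewrite Edh; unfold w at 2; ring).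
        unfold dN, N. fold w. rewrite E', Cmod2_alt.
        unfold Re, Im, Cconj, Cmult, Cplus, RtoC; simpl. ring. }
      change (Cmod (H w) ^ 2) with (N t) in B1, B2.
      split; apply (Rmult_le_reg_l t); try lra.
      + replace (t * (dN t * (1 + t * r))) with ((t * dN t) * (1 + t * r)) by ring. rewrite E. nra.
      + replace (t * (dN t * (1 - t * r))) with ((t * dN t) * (1 - t * r)) by ring. rewrite E. nra. }
  assert (N0 : N 0 = 1).
  { unfold N. replace (RtoC 0 * z)%C with (RtoC 0) by ring. rewrite HH0, Cmod_1. ring. }
  assert (N1 : N 1 = Cmod (H z) ^ 2).
  { unfold N. replace (RtoC 1 * z)%C with z by ring. reflexivity. }
  (* The sign [s] treats both monotone products at once: [s = -1] gives the upper bound, [s = 1] the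
     lower one. *)
  assert (HM : forall s, s = 1 \/ s = -1 -> forall t, 0 <= t <= 1 ->
     derivable_pt_lim (fun t => N t * (1 + s * (t * r)) ^ 4) t
       ((1 + s * (t * r)) ^ 3 * (dN t * (1 + s * (t * r)) + s * (4 * r * N t)))).
  { intros s Hs t Ht. apply is_derive_Reals.
    assert (D2 : is_derive (fun t => (1 + s * (t * r)) ^ 4) t (4 * s * r * (1 + s * (t * r)) ^ 3)).
    { auto_derive; auto. simpl. ring. }
    pose proof (is_derive_mult _ _ t _ _ (HN t Ht) D2 Rmult_comm) as D.
    evar_last. exact D. unfold plus, mult; simpl. ring. }
  pose proof (Cmod_ge_0 (H z)) as HHz.
  split.
  - destruct (MVT_cor2 _ _ 0 1 Rlt_0_1 (HM (-1) ltac:(auto))) as [c [Ec Hc]].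
    rewrite N0, N1 in Ec. destruct (HdN c Hc) as [_ B].
    assert (0 < (1 + -1 * (c * r)) ^ 3) by (apply pow_lt; nra).
    assert (Cmod (H z) ^ 2 * (1 + -1 * (1 * r)) ^ 4 <= 1).
    { assert ((1 + -1 * (c * r)) ^ 3 * (dN c * (1 + -1 * (c * r)) + -1 * (4 * r * N c)) <= 0) by nra.
      nra. }
    apply Rsqr_incr_0; try lra. unfold Rsqr. lra.
    apply Rmult_le_pos; auto. apply pow2_ge_0.
  - destruct (MVT_cor2 _ _ 0 1 Rlt_0_1 (HM 1 ltac:(auto))) as [c [Ec Hc]].
    rewrite N0, N1 in Ec. destruct (HdN c Hc) as [B _].
    assert (0 < (1 + 1 * (c * r)) ^ 3) by (apply pow_lt; nra).
    assert (1 <= Cmod (H z) ^ 2 * (1 + 1 * (1 * r)) ^ 4).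
    { assert (0 <= (1 + 1 * (c * r)) ^ 3 * (dN c * (1 + 1 * (c * r)) + 1 * (4 * r * N c))) by (apply Rmult_le_pos; lra).
      nra. }
    apply Rsqr_incr_0; try lra. unfold Rsqr. lra.
    apply Rmult_le_pos; auto. apply pow2_ge_0.
Qed.

(** By the triangle inequality [|dh - H| <= r |dh + H|] bounds each of [|dh|] and [|H|] by
    [(1 + r) / (1 - r)] times the other; the growth bounds for [|H|] supply the remaining two
    powers. *)
Lemma starlike_distortion (h dh : C -> C) (z : C) :
  (forall w, Cmod w < 1 -> Cderiv h w (dh w) /\ dh w <> 0) ->
  starlike_analytic h -> dh 0 = 1 -> Cmod z < 1 ->
  Cmod (dh z) * (1 - Cmod z) ^ 3 <= 1 + Cmod z /\ 1 - Cmod z <= Cmod (dh z) * (1 + Cmod z) ^ 3.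
Proof.
  intros Hd Hs Hdh0 Hz. pose proof (Cmod_ge_0 z) as Hz0.
  assert (Hh0 : h 0 = 0) by apply Hs.
  assert (Hholo : holo_on 1 h) by (intros w Hw; exists (dh w); now apply Hd).
  destruct (holo_on_quotient h 1 1 Rlt_0_1 Hholo Hh0) as [H [HH [HH0 Hfac]]].
  { rewrite <- Hdh0. apply Hd. rewrite Cmod_0. lra. }
  assert (Hch : forall w, exists l, Cmod w < 1 -> Cderiv H w l).
  { intros w. destruct (classic (Cmod w < 1)) as [Hw|n].
    - destruct (HH w Hw) as [l Hl]. now exists l.
    - exists 0. tauto. }
  set (dH := fun w => proj1_sig (constructive_indefinite_description _ (Hch w))).
  assert (HdH : forall w, Cmod w < 1 -> Cderiv H w (dH w)).
  { intros w. exact (proj2_sig (constructive_indefinite_description _ (Hch w))). }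
  (* A zero of [H] away from 0 would be a second zero of the injective [h]. *)
  assert (Hne : forall w, Cmod w < 1 -> H w <> 0).
  { intros w Hw E. destruct (classic (w = 0)) as [->|n].
    - rewrite HH0 in E. injection E. lra.
    - apply n. apply (proj1 (proj2 Hs)).
      + exact Hw.
      + unfold unit_disc. rewrite Cmod_0. lra.
      + rewrite Hfac, E, Hh0. ring. }
  assert (Hb : forall w, Cmod w < 1 -> Cmod (dh w - H w) <= Cmod w * Cmod (dh w + H w)).
  { intros w Hw. now apply (starlike_schwarz h). }
  destruct (growth h dh H dH z) as [G1 G2]; auto. { intros w Hw. now apply Hd. }
  specialize (Hb z Hz).
  pose proof (Cmod_triangle (dh z) (H z)) as T1.
  pose proof (Cmod_reverse_triangle (dh z) (H z)) as T2.
  pose proof (Cmod_reverse_triangle (H z) (dh z)) as T3. rewrite Cmod_minus_sym in T3.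
  set (r := Cmod z) in *. set (d := Cmod (dh z)) in *. set (a := Cmod (H z)) in *.
  assert (K1 : d * (1 - r) <= (1 + r) * a) by nra.
  assert (K2 : a * (1 - r) <= (1 + r) * d) by nra.
  split.
  - apply (Rmult_le_compat_r ((1 - r) ^ 2)) in K1; [|apply pow2_ge_0].
    apply (Rmult_le_compat_l (1 + r)) in G1; [|lra]. lra.
  - apply (Rmult_le_compat_r ((1 + r) ^ 2)) in K2; [|apply pow2_ge_0].
    apply (Rmult_le_compat_l (1 - r)) in G2; [|lra]. lra.
Qed.

(** * Schwarz-Pick bounds and the Jacobian estimate *)

(** With [x = |w z|] and [r = |z|], the left side is [(x - alpha)^2 - r^2 (1 - alpha x)^2] factored
    as a difference of squares. It encodes the upper and the lower bound for [x] together. *)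
Lemma schwarz_pick_origin (w : C -> C) (alpha : R) (z : C) :
  holo_on 1 w -> (forall x, Cmod x < 1 -> Cmod (w x) < 1) -> Cmod (w 0) = alpha -> Cmod z < 1 ->
  ((1 + alpha * Cmod z) * Cmod (w z) - (alpha + Cmod z)) *
  ((1 - alpha * Cmod z) * Cmod (w z) - (alpha - Cmod z)) <= 0.
Proof.
  intros Hw Hb Ha Hz. set (b := w 0) in *.
  assert (Hb1 : Cmod b < 1) by (apply Hb; rewrite Cmod_0; lra).
  pose proof (Cmod_ge_0 b) as Hb0.
  assert (Hden : forall x, Cmod x < 1 -> 0 < Cmod (1 - Cconj b * w x)).
  { intros x Hx. pose proof (Cmod_reverse_triangle 1 (Cconj b * w x)) as T.
    rewrite Cmod_1, Cmod_mult, Cmod_conj in T. specialize (Hb x Hx). pose proof (Cmod_ge_0 (w x)). nra. }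
  assert (HS : Cmod (w z - b) <= Cmod z * Cmod (1 - Cconj b * w z)).
  { assert (S : Cmod ((w z - b) / (1 - Cconj b * w z)) <= Cmod z).
    { apply (schwarz (fun x => (w x - b) / (1 - Cconj b * w x))%C); auto.
      - intros x Hx. destruct (Hw x Hx) as [l Hl].
        eexists. apply (Cderiv_div (fun x => w x - b)%C (fun x => 1 - Cconj b * w x)%C).
        + apply Cderiv_minus. exact Hl. apply Cderiv_const.
        + apply Cderiv_minus. apply Cderiv_const. apply (Cderiv_mult (fun _ => Cconj b) w).
          apply Cderiv_const. exact Hl.
        + apply Cmod_gt_0; auto.
      - fold b. replace (b - b)%C with (RtoC 0) by ring. unfold Cdiv. ring.
      - intros x Hx. specialize (Hden x Hx). rewrite Cmod_div by (apply Cmod_gt_0; auto).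
        apply (Rmult_le_reg_r (Cmod (1 - Cconj b * w x))); auto.
        unfold Rdiv. rewrite Rmult_assoc, Rinv_l, Rmult_1_r, Rmult_1_l by lra.
        apply Rsqr_incr_0; try apply Cmod_ge_0. rewrite !Rsqr_pow2.
        assert (E : Cmod (1 - Cconj b * w x) ^ 2 - Cmod (w x - b) ^ 2
                    = (1 - Cmod b ^ 2) * (1 - Cmod (w x) ^ 2)).
        { rewrite !Cmod2_alt. unfold Re, Im, Cconj, Cmult, Cminus, Cplus, Copp, RtoC; simpl. ring. }
        specialize (Hb x Hx). pose proof (Cmod_ge_0 (w x)).
        assert (0 <= (1 - Cmod b ^ 2) * (1 - Cmod (w x) ^ 2)) by (apply Rmult_le_pos; nra). lra. }
    specialize (Hden z Hz). rewrite Cmod_div in S by (apply Cmod_gt_0; auto).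
    apply (Rmult_le_compat_r (Cmod (1 - Cconj b * w z))) in S; [|lra].
    unfold Rdiv in S. rewrite Rmult_assoc, Rinv_l, Rmult_1_r in S by lra. exact S. }
  pose proof (Cmod_ge_0 z) as Hz0. pose proof (Cmod_ge_0 (w z)) as Hx0.
  set (c := Re (Cconj b * w z)).
  assert (Hc : c <= alpha * Cmod (w z)).
  { rewrite <- Ha, <- (Cmod_conj b), <- Cmod_mult. apply Re_le_Cmod. }
  assert (E1 : Cmod (w z - b) ^ 2 = Cmod (w z) ^ 2 + alpha ^ 2 - 2 * c).
  { rewrite <- Ha. unfold c. rewrite !Cmod2_alt. unfold Re, Im, Cconj, Cmult, Cminus, Cplus, Copp, RtoC; simpl. ring. }
  assert (E2 : Cmod (1 - Cconj b * w z) ^ 2 = 1 + alpha ^ 2 * Cmod (w z) ^ 2 - 2 * c).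
  { rewrite <- Ha. unfold c. rewrite !Cmod2_alt. unfold Re, Im, Cconj, Cmult, Cminus, Cplus, Copp, RtoC; simpl. ring. }
  assert (S2 : Cmod (w z - b) ^ 2 <= Cmod z ^ 2 * Cmod (1 - Cconj b * w z) ^ 2).
  { rewrite <- Rpow_mult_distr. apply pow_incr. split; auto. apply Cmod_ge_0. }
  rewrite E1, E2 in S2.
  (* The same [- 2 c] occurs on both sides of [S2], with net weight [1 - |z|^2 >= 0], so [c] may be
     replaced by its upper bound [alpha |w z|]. *)
  assert ((1 - Cmod z ^ 2) * c <= (1 - Cmod z ^ 2) * (alpha * Cmod (w z))) by (apply Rmult_le_compat_l; nra).
  nra.
Qed.

(** As in [Re_quotient_bounds], a linear combination of known sign forces [P <= 0 <= Q]. Then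
    [(1 + alpha r)^2 - (alpha + r)^2] and [(1 - alpha r)^2 - (alpha - r)^2] both equal
    [(1 - alpha^2)(1 - r^2)]. Squaring the lower bound for [x] uses [alpha - r >= 0]. *)
Lemma one_minus_sqr_bounds (alpha r x : R) :
  0 <= alpha < 1 -> 0 <= r < 1 -> 0 <= x ->
  ((1 + alpha * r) * x - (alpha + r)) * ((1 - alpha * r) * x - (alpha - r)) <= 0 ->
  (1 - alpha ^ 2) * (1 - r ^ 2) <= (1 + alpha * r) ^ 2 * (1 - x ^ 2) /\
  (r < alpha -> (1 - alpha * r) ^ 2 * (1 - x ^ 2) <= (1 - alpha ^ 2) * (1 - r ^ 2)).
Proof.
  intros Ha Hr Hx H.
  set (P := (1 + alpha * r) * x - (alpha + r)) in *. set (Q := (1 - alpha * r) * x - (alpha - r)) in *.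
  assert (Har : 0 <= alpha * r < 1) by nra.
  assert (D : (1 + alpha * r) * Q - (1 - alpha * r) * P = 2 * r * (1 - alpha ^ 2)) by (unfold P, Q; ring).
  assert (D0 : 0 <= 2 * r * (1 - alpha ^ 2)) by (apply Rmult_le_pos; nra).
  assert (HP : P <= 0). { apply Rnot_lt_le. intros HP. assert (Q <= 0) by nra. nra. }
  assert (HQ : 0 <= Q). { apply Rnot_lt_le. intros HQ. assert (0 <= P) by nra. nra. }
  split.
  - assert (((1 + alpha * r) * x) ^ 2 <= (alpha + r) ^ 2).
    { apply pow_incr. split. apply Rmult_le_pos; lra. unfold P in HP. lra. }
    lra.
  - intros Hra. assert ((alpha - r) ^ 2 <= ((1 - alpha * r) * x) ^ 2).
    { apply pow_incr. split. lra. unfold Q in HQ. lra. }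
    lra.
Qed.

(** The exponents 3 and 5 come from squaring the distortion bound, with powers 2 and 6, and
    cancelling one factor of [1 - r^2 = (1 - r)(1 + r)] against the sixth power. For [alpha <= r]
    the factor [1 - x^2] is simply bounded by 1. *)
Lemma jacobian_algebra (alpha r x d : R) :
  0 <= alpha < 1 -> 0 <= r < 1 -> 0 <= x < 1 -> 0 <= d ->
  ((1 + alpha * r) * x - (alpha + r)) * ((1 - alpha * r) * x - (alpha - r)) <= 0 ->
  d * (1 - r) ^ 3 <= 1 + r -> 1 - r <= d * (1 + r) ^ 3 ->
  (1 - alpha ^ 2) * (1 - r) ^ 3 / ((1 + alpha * r) ^ 2 * (1 + r) ^ 5) <= d ^ 2 * (1 - x ^ 2) /\
  (r < alpha ->
     d ^ 2 * (1 - x ^ 2) <= (1 - alpha ^ 2) * (1 + r) ^ 3 / ((1 - alpha * r) ^ 2 * (1 - r) ^ 5)) /\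
  (alpha <= r -> d ^ 2 * (1 - x ^ 2) <= (1 + r) ^ 2 / (1 - r) ^ 6).
Proof.
  intros Ha Hr Hx Hd Hpick Hu Hl.
  destruct (one_minus_sqr_bounds alpha r x Ha Hr (proj1 Hx) Hpick) as [B1 B2].
  assert (Har : 0 <= alpha * r < 1) by nra.
  assert (Hx2 : 0 <= 1 - x ^ 2) by nra.
  assert (Q0 : 0 <= (1 - alpha ^ 2) * (1 - r ^ 2)) by (apply Rmult_le_pos; nra).
  assert (Hu2 : d ^ 2 * (1 - r) ^ 6 <= (1 + r) ^ 2).
  { replace (d ^ 2 * (1 - r) ^ 6) with ((d * (1 - r) ^ 3) ^ 2) by ring. apply pow_incr.
    split; auto. apply Rmult_le_pos; auto. apply pow_le; lra. }
  assert (Hl2 : (1 - r) ^ 2 <= d ^ 2 * (1 + r) ^ 6).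
  { replace (d ^ 2 * (1 + r) ^ 6) with ((d * (1 + r) ^ 3) ^ 2) by ring. apply pow_incr. lra. }
  assert (P1 : 0 < 1 - r) by lra. assert (P2 : 0 < 1 + r) by lra.
  assert (HD : 0 <= d ^ 2) by apply pow2_ge_0.
  assert (Hdiv1 : forall a b c, 0 < c -> a <= b * c -> a / c <= b).
  { intros a b c Hc H. apply (Rmult_le_reg_r c); auto. unfold Rdiv. rewrite Rmult_assoc, Rinv_l; lra. }
  assert (Hdiv2 : forall a b c, 0 < c -> b * c <= a -> b <= a / c).
  { intros a b c Hc H. apply (Rmult_le_reg_r c); auto. unfold Rdiv. rewrite Rmult_assoc, Rinv_l; lra. }
  split; [|split].
  - apply Hdiv1. { apply Rmult_lt_0_compat; apply pow_lt; lra. }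
    assert (K : (1 - r) ^ 2 * ((1 - alpha ^ 2) * (1 - r ^ 2))
                <= (d ^ 2 * (1 + r) ^ 6) * ((1 + alpha * r) ^ 2 * (1 - x ^ 2))).
    { apply Rmult_le_compat; auto. apply pow2_ge_0. }
    apply (Rmult_le_reg_r (1 + r)); auto. lra.
  - intros Hra. specialize (B2 Hra).
    apply Hdiv2. { apply Rmult_lt_0_compat; apply pow_lt; lra. }
    assert (K : (d ^ 2 * (1 - r) ^ 6) * ((1 - alpha * r) ^ 2 * (1 - x ^ 2))
                <= (1 + r) ^ 2 * ((1 - alpha ^ 2) * (1 - r ^ 2))).
    { apply Rmult_le_compat; auto; apply Rmult_le_pos; auto; try apply pow2_ge_0.
      apply pow_le; lra. }
    apply (Rmult_le_reg_r (1 - r)); auto. lra.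
  - intros _. apply Hdiv2. { apply pow_lt; lra. }
    assert (0 <= d ^ 2 * (1 - r) ^ 6) by (apply Rmult_le_pos; auto; apply pow_le; lra).
    assert (0 <= x ^ 2) by apply pow2_ge_0. nra.
Qed.

Theorem theorem2p6 :
  forall (alpha : R) (f h g : C -> C),
    0 <= alpha < 1 ->
    L_H_starlike alpha f h g ->
    forall z : C, unit_disc z ->
      (1 - alpha ^ 2) * (1 - Cmod z) ^ 3
        / ((1 + alpha * Cmod z) ^ 2 * (1 + Cmod z) ^ 5)
      <= jacobian h g z
      /\ (Cmod z < alpha ->
          jacobian h g z <=
          (1 - alpha ^ 2) * (1 + Cmod z) ^ 3
            / ((1 - alpha * Cmod z) ^ 2 * (1 - Cmod z) ^ 5))
      /\ (alpha <= Cmod z ->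
          jacobian h g z <= (1 + Cmod z) ^ 2 / (1 - Cmod z) ^ 6).
Proof.
  intros alpha f h g Ha [[[Hh [Hg _]] [_ [Hsp [_ Hdh0]]]] [Hdg0 Hstar]] z Hz.
  assert (Dh : forall w, Cmod w < 1 -> Cderiv h w (C_derive h w)).
  { intros w Hw. apply Cderiv_correct, Hh, Hw. }
  assert (Dg : forall w, Cmod w < 1 -> Cderiv g w (C_derive g w)).
  { intros w Hw. apply Cderiv_correct, Hg, Hw. }
  assert (Hlt : forall w, Cmod w < 1 -> Cmod (C_derive g w) < Cmod (C_derive h w)).
  { intros w Hw. specialize (Hsp w Hw). unfold jacobian in Hsp.
    pose proof (Cmod_ge_0 (C_derive g w)). pose proof (Cmod_ge_0 (C_derive h w)).
    apply Rnot_le_lt. intros Hle. nra. }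
  assert (Hne : forall w, Cmod w < 1 -> C_derive h w <> 0).
  { intros w Hw. apply Cmod_gt_0. pose proof (Cmod_ge_0 (C_derive g w)). specialize (Hlt w Hw). lra. }
  (* The second dilatation of [f]. Since [h'(0) = 1], its value at 0 is [g'(0)], of modulus
     [alpha]. *)
  set (om := fun w => (C_derive g w / C_derive h w)%C).
  assert (Hom : holo_on 1 om).
  { intros w Hw.
    destruct (holo_on_deriv h (C_derive h) 1 Dh w Hw) as [a Da].
    destruct (holo_on_deriv g (C_derive g) 1 Dg w Hw) as [b Db].
    eexists. apply (Cderiv_div (C_derive g) (C_derive h)); eauto. }
  assert (Eom : forall w, Cmod w < 1 -> Cmod (C_derive g w) = Cmod (om w) * Cmod (C_derive h w)).
  { intros w Hw. rewrite <- Cmod_mult. f_equal. unfold om. field. auto. }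
  assert (Hom1 : forall w, Cmod w < 1 -> Cmod (om w) < 1).
  { intros w Hw. specialize (Hlt w Hw). rewrite Eom in Hlt by auto.
    pose proof (proj1 (Cmod_gt_0 _) (Hne w Hw)). nra. }
  assert (Hom0 : Cmod (om 0) = alpha).
  { rewrite <- Hdg0. unfold om. rewrite Hdh0. f_equal. field. }
  destruct (starlike_distortion h (C_derive h) z) as [B1 B2]; auto.
  replace (jacobian h g z) with (Cmod (C_derive h z) ^ 2 * (1 - Cmod (om z) ^ 2)).
  - apply jacobian_algebra; auto; try (split; auto); try apply Cmod_ge_0.
    now apply schwarz_pick_origin.
  - unfold jacobian. rewrite Eom by exact Hz. ring.
Qed.
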